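(* Assume hypotheses P1, P2, P3, P4 and P5. Then: 1. For any $x\in\mathbb X$ and $a\ge 0$, the sequence $\bigl(\mathbb E_{x,a}[S_n;\tau>n]\bigr)_{n\ge 0}$ converges to $V(x,a):=a-\mathbb E_{x,a}[M_\tau]$. 2. For any $x\in\mathbb X$, the function $V(x,\cdot)$ is increasing (i.e. non-decreasing) on $\mathbb R^+$. 3. There exist $c>0$ and $A>0$ such that for any $x\in\mathbb X$ and $a\ge 0$, $$\max\Bigl(\frac1c,\;a-A\Bigr)\le V(x,a)\le c(1+a).$$ 4. For any $x\in\mathbb X$, $\displaystyle\lim_{a\to+\infty}\frac{V(x,a)}{a}=1$. 5. The function $V$ is $\widetilde P_+$-harmonic, i.e. for any $x\in\mathbb X$ and $a\ge0$, $V(x,a)=\mathbb E_{x,a}[V(X_1,S_1);\tau>1]$.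
   Context: Setting. Fix an integer $d\ge 1$; $|x|=\sum_i|x_i|$ on $\mathbb R^d$; $\mathcal C=\{x\in\mathbb R^d: x_i\ge0\ \forall i\}$; $\mathbb X=\{x\in\mathcal C:|x|=1\}$. $S$ is the semigroup of $d\times d$ matrices with non-negative entries such that each column contains at least one positive entry; $\mathring S$ is the set of matrices with all entries $>0$. For $g\in S$, $x\in\mathbb X$: $g\cdot x=gx/|gx|$, $\rho(g,x)=\log|gx|$. For $g\in S$: $v(g)=\min_j\sum_i g(i,j)$, $|g|=\max_j\sum_i g(i,j)$, $N(g)=\max(1/v(g),|g|)$. Let $\mu$ be a probability measure on $S$ and $(g_n)_{n\ge1}$ i.i.d. with law $\mu$; $g_0=\mathrm{Id}$. For $x\in\mathbb X$, $a\in\mathbb R$, under $\mathbb P_{x,a}$ (expectation $\mathbb E_{x,a}$): $X_0=x$, $X_n=g_n\cdots g_1\cdot x$, $X_{-1}=X_0$, $S_0=a$, $S_n=a+\sum_{k=1}^n\rho(g_k,X_{k-1})$. $\mathbb E[Y;B]$ means $\mathbb E[Y\mathbf 1_B]$. $\tau=\min\{n\ge1:S_n\le 0\}$. Hypotheses. P1: there is $\delta_0>0$ with $\int_S N(g)^{\delta_0}\mu(dg)<+\infty$. P2: there is no affine subspace $A$ of $\mathbb R^d$ such that $A\cap\mathcal C$ is non-empty, bounded and invariant under the (linear) action of all elements of the support of $\mu$. P3: there is $n_0\ge1$ with $\mu^{*n_0}(\mathring S)>0$. Under P1-P3 there is a unique probability measure $\nu$ on $\mathbb X$ that is $\mu$-invariant,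 i.e. $\int_S\int_{\mathbb X}\varphi(g\cdot x)\nu(dx)\mu(dg)=\nu(\varphi)$ for bounded Borel $\varphi$; the upper Lyapunov exponent is $\gamma_\mu=\int_S\int_{\mathbb X}\rho(g,x)\,\nu(dx)\mu(dg)$. P4: $\gamma_\mu=0$. P5: there is $\delta>0$ with $\mu\{g\in S:\forall x\in\mathbb X,\ \log|gx|\ge\delta\}>0$. Martingale. For functions $\phi$ on $S\times\mathbb X$ let $\overline P\phi(g,x)=\int_S\phi(h,g\cdot x)\,\mu(dh)$. The series $\theta=\sum_{n\ge0}\overline P^n\rho$ converges pointwise on $S\times \mathbb X$. Put $M_0=S_0$ and $M_n=M_0+\sum_{k=0}^{n-1}[\theta(g_{k+1},X_k)-\overline P\theta(g_k,X_{k-1})]$. $V$ is extended by $V(x,a)=0$ for $a<0$.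
   Formalization: In P2 the intersection of A with the cone C is also required to differ from {0}; as printed, P2 can never hold, since A={0} gives the non-empty, bounded, invariant set {0}. The corrected P2 is implied by P5. *)

(* Defs.v *)
From HB Require Import structures.
From mathcomp Require Import all_boot all_order all_algebra.
From mathcomp Require Import all_classical all_reals all_analysis.
Set Implicit Arguments.
Unset Strict Implicit.
Unset Printing Implicit Defensive.
Import Order.TTheory GRing.Theory Num.Theory.
Import numFieldTopology.Exports numFieldNormedType.Exports.
Local Open Scope classical_set_scope.
Local Open Scope ring_scope.

(* The dimension (an integer >= 1) is written d.+1 throughout, vectors are     *)
(* columns. A probability measure on S (resp. on X) is represented by a Borel  *)
(* probability on all matrices (resp. vectors) giving mass 1 to the Borel set  *)
(* semiS (resp. simplex).                                                      *)

Definition borelM (R : realType) (d : nat) :=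
  g_sigma_algebraType (@open 'M[R]_d.+1).
Definition borelV (R : realType) (d : nat) :=
  g_sigma_algebraType (@open 'cV[R]_d.+1).

Section matrices.
Context {R : realType} {d : nat}.
Implicit Types (g : 'M[R]_d.+1) (x : 'cV[R]_d.+1).

Definition norm1 x : R := \sum_i `|x i ord0|.

Definition cone : set 'cV[R]_d.+1 := [set x | forall i, 0 <= x i ord0].

Definition simplex : set 'cV[R]_d.+1 := [set x | cone x /\ norm1 x = 1].

Definition semiS : set 'M[R]_d.+1 :=
  [set g | (forall i j, 0 <= g i j) /\ (forall j, exists i, 0 < g i j)].

Definition posS : set 'M[R]_d.+1 := [set g | forall i j, 0 < g i j].

Definition proj_act g x : 'cV[R]_d.+1 := (norm1 (g *m x))^-1 *: (g *m x).

Definition rho g x : R := ln (norm1 (g *m x)).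

Definition colsum g (j : 'I_d.+1) : R := \sum_i g i j.

(* The default values of the iterated min and max are values at an index of   *)
(* the range, hence neutral.                                                   *)
Definition mx_v g : R := \big[Num.min/colsum g ord0]_j colsum g j.
Definition mx_norm1 g : R := \big[Num.max/colsum g ord0]_j colsum g j.
Definition mx_N g : R := Num.max (mx_v g)^-1 (mx_norm1 g).

Definition affine_subspace (A : set 'cV[R]_d.+1) :=
  exists (p : 'cV[R]_d.+1) (W : {vspace 'cV[R]_d.+1}), A = [set x | x - p \in W].

End matrices.

Section hypotheses.
Context {R : realType} {d : nat}.
Implicit Types (mu : probability (borelM R d) R) (nu : probability (borelV R d) R).

(* Topological support, relative to S. *)
Definition msupport mu : set 'M[R]_d.+1 :=
  [set g | semiS g /\
     forall U : set 'M[R]_d.+1, open U -> U g -> (0 < mu U)%E].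

Definition mconv (mu1 mu2 : set (borelM R d) -> \bar R)
    (B : set (borelM R d)) : \bar R :=
  (\int[mu1]_g mu2 [set h | B ((g : 'M[R]_d.+1) *m (h : 'M[R]_d.+1))])%E.

Definition conv_pow mu (n : nat) : set (borelM R d) -> \bar R :=
  iter n (mconv mu) (dirac (1%:M : borelM R d)).

Definition hypP1 mu :=
  exists2 delta0 : R, 0 < delta0 &
    (\int[mu]_(g in semiS) ((mx_N g) `^ delta0)%:E < +oo)%E.

(* The condition A `&` cone <> [set 0] is needed for the hypothesis to be     *)
(* satisfiable: the affine subspace {0} meets the cone in {0}, which is        *)
(* bounded and invariant under every linear map. As soon as 0 is in A and      *)
(* A `&` cone is bounded, A `&` cone is {0}, so these are the only subspaces   *)
(* left out.                                                                   *)
Definition hypP2 mu :=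
  ~ exists A : set 'cV[R]_d.+1,
    [/\ affine_subspace A,
        A `&` cone !=set0 /\ A `&` cone <> [set 0],
        bounded_set (A `&` cone) &
        forall g, msupport mu g ->
          forall x, (A `&` cone) x -> (A `&` cone) (g *m x)].

Definition hypP3 mu :=
  exists2 n0 : nat, (0 < n0)%N & (0 < conv_pow mu n0 posS)%E.

Definition mu_invariant mu nu :=
  nu simplex = 1%E /\
  forall phi : borelV R d -> R, measurable_fun (simplex : set (borelV R d)) phi ->
    (exists M : R, forall x, simplex x -> `|phi x| <= M) ->
    (\int[mu]_(g in semiS) \int[nu]_(x in simplex) (phi (proj_act g x))%:E
     = \int[nu]_(x in simplex) (phi x)%:E)%E.

Definition upper_lyapunov mu nu : \bar R :=
  (\int[mu]_(g in semiS) \int[nu]_(x in simplex) (rho g x)%:E)%E.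

Definition hypP4 mu nu := upper_lyapunov mu nu = 0%E.

Definition hypP5 mu :=
  exists2 delta : R, 0 < delta &
    (0 < mu [set g | semiS g /\ forall x, simplex x -> (delta <= rho g x)%R])%E.

Definition Pbar mu (phi : 'M[R]_d.+1 -> 'cV[R]_d.+1 -> R)
    (g : 'M[R]_d.+1) (x : 'cV[R]_d.+1) : R :=
  \int[mu]_(h in semiS) phi h (proj_act g x).

Definition theta mu (g : 'M[R]_d.+1) (x : 'cV[R]_d.+1) : R :=
  limn (series (fun n => iter n (Pbar mu) rho g x)).

End hypotheses.

(* xi 0, xi 1, ... are the i.i.d. matrices g_1, g_2, ... *)
Definition iid_with_law {R : realType} {d : nat} (mu : probability (borelM R d) R)
    {dO : measure_display} {Omega : measurableType dO} (P : probability Omega R)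
    (xi : nat -> {RV P >-> borelM R d}) :=
  [/\ (forall n w, semiS (xi n w)),
      (forall n (B : set (borelM R d)), measurable B ->
         distribution P (xi n) B = mu B) &
      (forall (s : seq nat) (B : nat -> set (borelM R d)), uniq s ->
         (forall i, measurable (B i)) ->
         P (\bigcap_(i in [set` s]) (xi i @^-1` B i)) =
         (\prod_(i <- s) P (xi i @^-1` B i))%E)].

Section process.
Context {R : realType} {d : nat} (mu : probability (borelM R d) R).
Context {dO : measure_display} {Omega : measurableType dO}.
Context (P : probability Omega R) (xi : nat -> {RV P >-> borelM R d}).
Implicit Types (x : 'cV[R]_d.+1) (a : R) (n k : nat) (w : Omega).

Definition gmat n w : 'M[R]_d.+1 := if n is k.+1 then xi k w else 1%:M.

Fixpoint gprod n w : 'M[R]_d.+1 :=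
  if n is k.+1 then gmat k.+1 w *m gprod k w else 1%:M.

(* For x in the simplex, X_ x 0 = x; the convention X_{-1} = X_0 is rendered   *)
(* below by X_ x k.-1.                                                         *)
Definition X_ x n w : 'cV[R]_d.+1 := proj_act (gprod n w) x.

Definition S_ x a n w : R :=
  a + \sum_(1 <= k < n.+1) rho (gmat k w) (X_ x k.-1 w).

Definition M_ x a n w : R :=
  S_ x a 0 w + \sum_(0 <= k < n)
    (theta mu (gmat k.+1 w) (X_ x k w)
     - Pbar mu (theta mu) (gmat k w) (X_ x k.-1 w)).

(* None stands for +oo. *)
Definition tau x a w : option nat :=
  if pselect (exists n, (0 < n)%N && (S_ x a n w <= 0)) is left ex
  then Some (ex_minn ex) else None.

Definition tau_gt x a n : set Omega :=
  [set w | if tau x a w is Some m then (n < m)%N else True].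

(* The value at tau = +oo, a negligible event under the hypotheses of the      *)
(* theorem, is immaterial.                                                     *)
Definition M_tau x a w : R := if tau x a w is Some n then M_ x a n w else 0.

Definition Eon (Y : Omega -> \bar R) (B : set Omega) : \bar R :=
  (\int[P]_(w in B) Y w)%E.

Definition V x a : \bar R :=
  if a < 0 then 0%E else (a%:E - 'E_P[M_tau x a])%E.

End process.

(* Main.v *)
(* Iterating the matrices contracts a projective distance, so the averages P^n rbar of
   rbar(x) = E rho(g, x) converge to their nu-mean, which is 0, geometrically fast; hence
   h = sum_n P^n rbar is bounded, theta(g, x) = rho(g, x) + h(g.x), and
   M_n = S_n + h(X_n) - h(x) is a martingale at bounded distance from S_n.

   Everything then rests on one bound for the killed walk. Put y = s + h(x). For suitable
   A, beta > 0 the function (A + exp(-beta h(x))) exp(-eta y), truncated far below 0, is a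
   strict submartingale (P5 prevents the increments of M from vanishing: when they are
   small, h has to decrease). Hence the Green function of the killed walk applied to
   exp(-eta s) is bounded. As log N has exponential moments, the mean overshoot below 0
   from height s is O(exp(-eta s)), so that adding a multiple of the Green potential to
   s + h(x) + |h| gives a superharmonic function at bounded distance from s. This yields
   E[S_n; tau > n] <= a + C and P(tau > n) -> 0; optional stopping and Fatou's lemma then
   give the convergence to a - E M_tau, with a - C <= V(x, a) <= a + C. Finally V > 0 follows
   from harmonicity, letting the walk climb k steps of height at least delta. *)
From HB Require Import structures.
Require Import Defs.
From mathcomp Require Import all_boot all_order all_algebra.
From mathcomp Require Import all_classical all_reals all_analysis.
From mathcomp Require Import measurable_realfun ring lra.
Set Implicit Arguments.
Unset Strict Implicit.
Unset Printing Implicit Defensive.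
Import Order.TTheory GRing.Theory Num.Theory.
Import numFieldTopology.Exports numFieldNormedType.Exports.
Local Open Scope classical_set_scope.
Local Open Scope ring_scope.

(** The obstacle is a mismatch: up to a constant the martingale is [S_n + h(X_n)], while killing is
    decided by [S_n] alone and h is merely bounded. At the killing step [s + h(x) + B] may be
    negative, so discarding it can raise the mean, and this function need not be superharmonic near
    the boundary. The cost of a step from height s is at most a multiple of exp(-eta s); only a
    bound on the sum of these costs along the path keeps the correction bounded. That bound comes
    from an explicit bounded function, uniformly in the starting point, and not from a limit theorem
    for the walk. The killed walk is treated for an abstract i.i.d. action. It is given a bounded
    solution h of the Poisson equation, a bound [ell] of |rho| with an exponential moment, and a set
    [Gd] of positive mass on which rho >= delta. Conditioning on the past is done by identifying the
    joint law of the next matrix and the past with a product measure, so that every Markov step is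
    an instance of Fubini's theorem. *)

Section parametric_integral.
Context {d1 d2 : measure_display} {T1 : measurableType d1} {T2 : measurableType d2}.
Context {R : realType} (m1 : {sigma_finite_measure set T1 -> \bar R}).

(** Tonelli's theorem gives this for non-negative integrands; a signed [h] is restricted to [D]
    times the whole space, then split into positive and negative parts. *)
Lemma measurable_parametric_integral (D : set T1) (h : T1 * T2 -> \bar R) :
  measurable D -> measurable_fun setT h ->
  measurable_fun setT (fun y => \int[m1]_(x in D) h (x, y))%E.
Proof.
move=> mD mh.
have mDT : measurable (D `*` [set: T2]) by exact: measurableX.
pose hD := h \_ (D `*` setT).
have mhD : measurable_fun setT hD.
  by apply/(measurable_restrictT h mDT); exact: measurable_funTS.
rewrite (_ : (fun y => _) = (fun y => \int[m1]_x hD^\+ (x, y)) \-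
                            (fun y => \int[m1]_x hD^\- (x, y)))%E.
  apply: emeasurable_funB.
    apply: (measurable_fun_fubini_tonelli_G hD^\+%E) => //.
    exact: measurable_funepos.
  apply: (measurable_fun_fubini_tonelli_G hD^\-%E) => //.
  exact: measurable_funeneg.
apply/funext => y /=; rewrite integral_mkcond.
rewrite (_ : _ \_ D = hD \o (fun x => (x, y))).
  rewrite integralE; congr (_ - _)%E; apply: eq_integral => x _.
    by rewrite funepos_comp.
  by rewrite funeneg_comp.
apply/funext => x; rewrite /hD /= !patchE.
by congr (if _ then _ else _); apply/idP/idP; rewrite !inE => //= -[].
Qed.

End parametric_integral.

(** * Independence of the next matrix from the past *)

Section independence.
Context {R : realType} {dG : measure_display} {G : measurableType dG}.
Context (mu : probability G R).
Context {dO : measure_display} {Omega : measurableType dO}.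
Context (P : probability Omega R).
Variable xi : nat -> Omega -> G.

Definition iid_seq :=
  [/\ forall n, measurable_fun setT (xi n),
      forall n B, measurable B -> P (xi n @^-1` B) = mu B &
      forall (s : seq nat) (B : nat -> set G), uniq s ->
        (forall i, measurable (B i)) ->
        P (\bigcap_(i in [set` s]) (xi i @^-1` B i)) =
        (\prod_(i <- s) P (xi i @^-1` B i))%E].

Hypothesis hxi : iid_seq.

(** A pi-system generating the sigma-algebra of [xi 0], ..., [xi n.-1]; [past n] below is [Omega]
    with that smaller sigma-algebra. *)
Definition cylinders n : set (set Omega) :=
  [set E | exists2 B : nat -> set G, (forall i, measurable (B i)) &
     E = \bigcap_(i in [set` iota 0 n]) (xi i @^-1` B i)].

Local Notation past n := (g_sigma_algebraType (cylinders n)).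

Lemma cylinders_measurable n : cylinders n `<=` measurable.
Proof.
move=> _ [B mB ->]; apply: bigcap_measurableType => i _.
by case: hxi => mxi _ _; rewrite -[X in measurable X]setTI; exact: mxi.
Qed.

Lemma past_measurable n (E : set (past n)) :
  measurable E -> measurable (E : set Omega).
Proof.
apply: smallest_sub; last exact: cylinders_measurable.
exact: sigma_algebra_measurable.
Qed.

Lemma measurable_to_past n : measurable_fun setT (id : Omega -> past n).
Proof. by move=> _ E mE; rewrite setTI preimage_id; apply: past_measurable mE. Qed.

Lemma measurable_of_past n d (T : measurableType d) (f : Omega -> T) :
  measurable_fun (setT : set (past n)) f -> measurable_fun setT f.
Proof.
move=> mf _ B mB; rewrite setTI; apply: (@past_measurable n).
by have := mf measurableT B mB; rewrite setTI.
Qed.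

Lemma measurable_xi_past n i : (i < n)%N ->
  measurable_fun setT (xi i : past n -> G).
Proof.
move=> ilt _ B mB; rewrite setTI; apply: sub_sigma_algebra.
exists (fun j => if j == i then B else setT).
  by move=> j; case: ifP.
apply/seteqP; split => w /=.
  by move=> Bw j _ /=; case: ifPn => // /eqP ->.
by move=> /(_ i); rewrite /= mem_iota eqxx add0n; apply.
Qed.

Lemma cylinders_setI_closed n : setI_closed (cylinders n).
Proof.
move=> _ _ [B mB ->] [C mC ->]; exists (fun i => B i `&` C i).
  by move=> i; exact: measurableI.
by rewrite -bigcapI; apply: eq_bigcapr => i _; rewrite preimage_setI.
Qed.

(** Both sides are finite measures in [E]: [P] restricted to the event on [xi n], and [P] scaled by
    [mu B]. Independence makes them agree on cylinders, hence on the sigma-algebra these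
    generate. *)
Lemma past_indep n (B : set G) (E : set (past n)) : measurable B -> measurable E ->
  P (xi n @^-1` B `&` E) = (mu B * P E)%E.
Proof.
move=> mB mE; case: (hxi) => mxi lxi ixi.
have mxiB : measurable (xi n @^-1` B).
  by rewrite -[X in measurable X]setTI; exact: mxi.
pose m1 := mrestr P mxiB.
have muBge0 : (0 <= fine (mu B))%R by apply: fine_ge0.
pose m2 := mscale (NngNum muBge0) P.
have -> : P (xi n @^-1` B `&` E) = m1 E by rewrite /m1 /mrestr/= setIC.
have -> : (mu B * P E)%E = m2 E.
  by rewrite /m2 /mscale/= fineK// fin_num_measure.
apply: (g_sigma_algebra_measure_unique (cylinders n) _ (fun=> setT)) => //.
- exact: cylinders_measurable.
- move=> _; exists (fun=> setT) => //.
  by apply/seteqP; split.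
- by rewrite bigcup_const//; exists 0%N.
- exact: cylinders_setI_closed.
- move=> _ [C mC ->].
  rewrite -[LHS]/(P (_ `&` xi n @^-1` B)) -[RHS]/((fine (mu B))%:E * P _)%E.
  rewrite fineK ?fin_num_measure//.
  (* A cylinder over n + 1 indices whose last base is [B]: the product formula for it isolates the
     factor [mu B]. *)
  pose D i := if i == n then B else C i.
  have mD i : measurable (D i) by rewrite /D; case: ifP.
  have := ixi (iota 0 n.+1) D (iota_uniq _ _) mD.
  rewrite -addn1 iotaD big_cat/= big_seq1.
  rewrite (_ : xi _ @^-1` D _ = xi n @^-1` B) /D add0n ?eqxx// lxi//.
  rewrite (_ : \bigcap_(i in _) _ = \bigcap_(i in [set` iota 0 n])
    (xi i @^-1` C i) `&` xi n @^-1` B).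
    move=> ->; rewrite muleC; congr (_ * _)%E.
    rewrite ixi ?iota_uniq//; apply: eq_big_seq => i.
    by rewrite mem_iota/= add0n; case: eqP => // ->; rewrite ltnn.
  apply/seteqP; split => w.
    move=> h; split.
      move=> i /= ii; have := h i; rewrite /= mem_cat ii /= => /(_ isT).
      by move: ii; rewrite mem_iota/= add0n; case: eqP => // ->; rewrite ltnn.
    by have := h n; rewrite /= mem_cat eqxx inE eqxx orbT; apply.
  move=> [h Bw] i /=; rewrite mem_cat inE => /orP[ii|/eqP ->]; last by rewrite eqxx.
  by case: eqP => [->//|_]; exact: h.
- move=> _; rewrite -[ltLHS]/(P (_ `&` xi n @^-1` B)).
  by rewrite (le_lt_trans (probability_le1 _ _)) ?ltry//; exact: measurableI.
Qed.

Definition past_id n : {mfun Omega >-> past n} :=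
  mfun_Sub (mem_set (@measurable_to_past n)).

Lemma measurable_xi_now n :
  measurable_fun setT (fun w : Omega => (xi n w, (w : past n))).
Proof.
case: hxi => mxi _ _.
by apply: measurable_fun_pair; [exact: mxi|exact: measurable_to_past].
Qed.

Definition xi_now n : {mfun Omega >-> (G * past n)%type} :=
  mfun_Sub (mem_set (@measurable_xi_now n)).

(** The second component is the identity from [Omega] to [past n], so any function of [xi n] and of
    what precedes it can be integrated by Fubini; this stands in for conditional expectations. *)
Lemma joint_law n (C : set (G * past n)) : measurable C ->
  (mu \x distribution P (past_id n))%E C = distribution P (xi_now n) C.
Proof.
move=> mC; apply: product_measure_unique => // A B mA mB.
exact: past_indep.
Qed.

Section indep_integral.
Variables (n : nat) (D : set G).
Hypotheses (mD : measurable D) (xiD : forall w, D (xi n w)).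

Let mDT : measurable (D `*` [set: past n]).
Proof. exact: measurableX. Qed.

Lemma ge0_indep_integral (f : G * past n -> \bar R) :
  measurable_fun setT f -> (forall g w, D g -> 0 <= f (g, w))%E ->
  (\int[P]_w f (xi n w, w) = \int[P]_w \int[mu]_(g in D) f (g, w))%E.
Proof.
move=> mf f0.
pose fD := f \_ (D `*` setT).
have mfD : measurable_fun setT fD.
  apply/(measurable_restrictT f mDT).
  exact: measurable_funTS.
have fD0 z : (0 <= fD z)%E.
  rewrite /fD patchE; case: ifPn => //; case: z => g w.
  by rewrite inE => -[/= Dg _]; exact: f0.
transitivity (\int[P]_w (fD \o xi_now n) w)%E.
  apply: eq_integral => w _; rewrite /= /fD patchE mem_set//=; split => //; exact: xiD.
transitivity (\int[distribution P (xi_now n)]_z fD z)%E.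
  by apply/esym; exact: ge0_integral_distribution.
transitivity (\int[mu \x distribution P (past_id n)]_z fD z)%E.
  by apply: eq_measure_integral => C mC _; exact/esym/joint_law.
rewrite fubini_tonelli2//.
etransitivity.
  apply: (ge0_integral_distribution (P := P) (past_id n)).
    exact: measurable_fun_fubini_tonelli_G.
  by move=> y; apply: integral_ge0.
apply: eq_integral => w _; rewrite /= [RHS]integral_mkcond.
apply: eq_integral => g _; rewrite /fD !patchE.
by congr (if _ then _ else _); apply/idP/idP; rewrite !inE => //= -[].
Qed.

(** The dominating function depends on the matrix alone, so its integral bounds the inner integrals
    of both parts uniformly in the past. *)
Lemma indep_integral (f : G * past n -> R) (k : G -> R) :
  measurable_fun setT f -> mu.-integrable D (EFin \o k) ->
  (forall g w, D g -> `|f (g, w)| <= k g) ->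
  P.-integrable setT (fun w => (f (xi n w, w))%:E) /\
  (\int[P]_w (f (xi n w, w))%:E = \int[P]_w \int[mu]_(g in D) (f (g, w))%:E)%E.
Proof.
move=> mf ik fk.
pose F := EFin \o f.
have mF : measurable_fun setT F by exact/measurable_EFinP.
have pos : measurable_fun setT F^\+%E by exact: measurable_funepos.
have neg : measurable_fun setT F^\-%E by exact: measurable_funeneg.
pose K := (\int[mu]_(g in D) (k g)%:E)%E.
have Kfin : K \is a fin_num by exact: integrable_fin_num.
have mk : measurable_fun D (EFin \o k) by exact: measurable_int ik.
have bnd (h : G * past n -> \bar R) : measurable_fun setT h ->
    (forall z, 0 <= h z)%E -> (forall z, h z <= `|F z|)%E ->
    P.-integrable setT (fun w => \int[mu]_(g in D) h (g, w))%E.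
  move=> mh h0 hF.
  have mI : measurable_fun (setT : set Omega)
      (fun w => \int[mu]_(g in D) h (g, w))%E.
    apply: (measurableT_comp (measurable_parametric_integral mu mD mh)).
    exact: measurable_to_past.
  apply/integrableP; split => //.
  apply: (@le_lt_trans _ _ (\int[P]_w K)%E); last first.
    by rewrite integral_cst//= probability_setT mule1 ltey_eq Kfin.
  apply: ge0_le_integral => //.
  - exact: measurableT_comp.
  - move=> w _; rewrite gee0_abs ?integral_ge0//.
    apply: ge0_le_integral => //.
    + by apply: measurable_funTS; apply: (@measurable_fun_pair1 _ _ _ _ (past n) _ h w).
    + by move=> g Dg; rewrite (le_trans (hF _))//= lee_fin; exact: fk.
have Fp z : (F^\+ z <= `|F z|)%E by rewrite -/((abse \o F) z) fune_abse leeDl.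
have Fn z : (F^\- z <= `|F z|)%E by rewrite -/((abse \o F) z) fune_abse leeDr.
have ip := bnd _ pos (fun=> funepos_ge0 _ _) Fp.
have ineg := bnd _ neg (fun=> funeneg_ge0 _ _) Fn.
have ep : (\int[P]_w F^\+ (xi n w, w) = \int[P]_w \int[mu]_(g in D) F^\+ (g, w))%E.
  exact: ge0_indep_integral.
have en : (\int[P]_w F^\- (xi n w, w) = \int[P]_w \int[mu]_(g in D) F^\- (g, w))%E.
  exact: ge0_indep_integral.
have splitF w : ((\int[mu]_(g in D) F^\+ (g, w)) - (\int[mu]_(g in D) F^\- (g, w)) =
    \int[mu]_(g in D) (f (g, w))%:E)%E.
  rewrite [RHS]integralE.
  apply: (f_equal2 (fun a b : \bar R => a - b)%E).
    apply: eq_integral => g _.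
    by rewrite funepos.unlock.
  apply: eq_integral => g _.
  by rewrite funeneg.unlock.
have mFxi (h : G * past n -> \bar R) : measurable_fun setT h ->
    measurable_fun (setT : set Omega) (fun w => h (xi n w, w)).
  by move=> mh; apply: (measurableT_comp mh); exact: measurable_xi_now.
split.
  rewrite (_ : (fun w => _) = (fun w => F^\+ (xi n w, w) - F^\- (xi n w, w))%E).
    apply: integrableB => //; apply/integrableP; split.
    - exact: mFxi.
    - under eq_integral do rewrite gee0_abs//.
      by rewrite ep (integrable_lty measurableT ip).
    - exact: mFxi.
    - under eq_integral do rewrite gee0_abs//.
      by rewrite en (integrable_lty measurableT ineg).
  by apply/funext => w; rewrite -[RHS]/((F^\+ \- F^\-)%E _) -funeposneg.
rewrite [LHS]integralE; under [RHS]eq_integral do rewrite -splitF.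
rewrite (integralB measurableT ip ineg) -ep -en.
apply: (f_equal2 (fun a b : \bar R => a - b)%E); apply: eq_integral => w _.
  by rewrite funepos.unlock.
by rewrite funeneg.unlock.
Qed.
End indep_integral.

End independence.

(** From exp(s - t) >= 1 + s - t and exp(-s) <= 1. The quantity is the gap between exp and its
    tangent at 0; it measures the gain by convexity in [rising_weight]. *)
Lemma ler_expRN_sub1D (R : realType) (s t : R) : 0 <= s -> s <= t ->
  expR (- s) - 1 + s <= expR (- t) - 1 + t.
Proof.
move=> s0 st; have -> : - t = - s + (s - t) by ring.
rewrite expRD; have := expR_ge1Dx (s - t).
have : expR (- s) <= 1 by rewrite -expR0 ler_expR; lra.
have := expR_gt0 (- s); move: (expR (- s)) (expR (s - t)) => a b; nra.
Qed.

Lemma expRN_sub1D_gt0 (R : realType) (s : R) : 0 < s -> 0 < expR (- s) - 1 + s.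
Proof. by move=> s0; have := @expR_gt1Dx R (- s); lra. Qed.

(** * The killed walk of an abstract i.i.d. action: moment estimates *)

Section killed_walk.
Context {R : realType} {dG dE : measure_display}.
Context {G : measurableType dG} {E : measurableType dE}.
Context (mu : probability G R).
Variables (SG : set G) (SE : set E) (act : G -> E -> E) (rho : G -> E -> R).
Variables (h : E -> R) (ell : G -> R) (Gd : set G) (eta delta B : R).
Hypotheses (mSG : measurable SG) (muSG : mu SG = 1%E).
Hypothesis mact : measurable_fun setT (fun z : G * E => act z.1 z.2).
Hypothesis mrho : measurable_fun setT (fun z : G * E => rho z.1 z.2).
Hypotheses (mh : measurable_fun setT h) (mell : measurable_fun setT ell).
Hypothesis act_stable : forall g x, SG g -> SE x -> SE (act g x).
Hypothesis eta_gt0 : 0 < eta.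
Hypothesis rho_ell : forall g x, SG g -> SE x -> `|rho g x| <= ell g.
Hypothesis iell : mu.-integrable SG (fun g => (expR (2 * eta * ell g))%:E).
Hypothesis hB : forall x, `|h x| <= B.
Hypothesis poisson : forall x, SE x ->
  (\int[mu]_(g in SG) (rho g x + h (act g x) - h x)%:E = 0)%E.
Hypotheses (mGd : measurable Gd) (GdSG : Gd `<=` SG) (muGd : (0 < mu Gd)%E).
Hypothesis delta_gt0 : 0 < delta.
Hypothesis rho_delta : forall g x, Gd g -> SE x -> delta <= rho g x.
Hypothesis SE0 : SE !=set0.

Let p := fine (mu Gd).
Let I := fine (\int[mu]_(g in SG) (expR (2 * eta * ell g))%:E)%E.

Definition increment g x := rho g x + h (act g x) - h x.

Lemma p_gt0 : 0 < p.
Proof. by rewrite /p fine_gt0// muGd ltey_eq fin_num_measure. Qed.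

Lemma p_le1 : p <= 1.
Proof.
by rewrite -lee_fin /p fineK ?fin_num_measure// probability_le1.
Qed.

Lemma ell_ge0 g : SG g -> 0 <= ell g.
Proof. by case: SE0 => x xS gS; rewrite (le_trans _ (rho_ell gS xS)). Qed.

Lemma B_ge0 : 0 <= B.
Proof. by case: SE0 => x _; rewrite (le_trans _ (hB x)). Qed.

Lemma ell_le_exp g : SG g -> ell g <= (2 * eta)^-1 * expR (2 * eta * ell g).
Proof.
move=> gS; have e0 : 0 < 2 * eta by rewrite mulr_gt0.
rewrite mulrC ler_pdivlMr// mulrC (le_trans _ (expR_ge1Dx _))//.
by rewrite lerDr.
Qed.

Lemma measurable_act x : measurable_fun setT (act ^~ x).
Proof. exact: (measurable_fun_pair1 x mact). Qed.

Lemma measurable_rho x : measurable_fun setT (rho ^~ x).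
Proof. exact: (measurable_fun_pair1 x mrho). Qed.

Lemma measurable_increment x : measurable_fun setT (increment ^~ x).
Proof.
apply: measurable_funB => //; apply: measurable_funD.
  exact: measurable_rho.
exact: (measurableT_comp mh (measurable_act x)).
Qed.

Lemma integrable_ell : mu.-integrable SG (EFin \o ell).
Proof.
have := integrableZl mSG (2 * eta)^-1 iell.
apply: le_integrable => //.
  by apply/measurable_EFinP; apply: measurable_funTS.
move=> g gS /=; rewrite lee_fin ger0_norm ?ell_ge0// ger0_norm.
  exact: ell_le_exp.
by rewrite mulr_ge0 ?expR_ge0// invr_ge0 mulr_ge0// ltW.
Qed.

Lemma increment_le g x : SG g -> SE x -> `|increment g x| <= ell g + 2 * B.
Proof.
move=> gS xS; rewrite /increment.
have := rho_ell gS xS; have := hB x; have := hB (act g x).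
rewrite !ler_norml => /andP[? ?] /andP[? ?] /andP[? ?].
by apply/andP; split; lra.
Qed.

Lemma integrable_ellD c : mu.-integrable SG (fun g => (ell g + c)%:E).
Proof.
apply: (integrableD mSG integrable_ell (g := fun=> c%:E)).
exact: finite_measure_integrable_cst.
Qed.

Lemma integrable_increment x : SE x ->
  mu.-integrable SG (fun g => (increment g x)%:E).
Proof.
move=> xS; apply: le_integrable (integrable_ellD (2 * B)) => //.
  by apply/measurable_EFinP; apply: measurable_funTS; exact: measurable_increment.
move=> g gS /=; rewrite lee_fin [leRHS]ger0_norm ?increment_le//.
by rewrite addr_ge0 ?ell_ge0// mulr_ge0// B_ge0.
Qed.

(** One-step estimates are reduced to this family: the increment integrates to 0 by the Poisson
    equation, the indicator to [p] and the exponential to [I], so the coefficient [b] leaves no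
    trace. *)
Lemma integral_majorant (x : E) (a b c e : R) : SE x ->
  let f g := (a + b * increment g x + c * \1_Gd g +
              e * expR (2 * eta * ell g))%:E in
  mu.-integrable SG f /\ (\int[mu]_(g in SG) f g = (a + c * p + e * I)%:E)%E.
Proof.
move=> xS f.
have i1 : mu.-integrable SG (fun=> a%:E) by exact: finite_measure_integrable_cst.
have i2 := integrableZl mSG b (integrable_increment xS).
have iGd : mu.-integrable SG (fun g => (\1_Gd g)%:E).
  exact: (integrableS measurableT mSG (@subsetT _ _) (integrable_indic _ mGd)).
have i3 : mu.-integrable SG (fun g => (c * \1_Gd g)%:E).
  by apply: (integrableZl mSG c (f := fun g => (\1_Gd g)%:E)).
have i4 := integrableZl mSG e iell.
have fE : f = ((((fun=> a%:E) \+ (fun g => b%:E * (increment g x)%:E)) \+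
   (fun g => (c * \1_Gd g)%:E)) \+ (fun g => e%:E * (expR (2 * eta * ell g))%:E))%E.
  by apply/funext.
have i12 := integrableD mSG i1 i2; have i123 := integrableD mSG i12 i3.
rewrite fE; split; first exact: (integrableD mSG i123 i4).
rewrite integralD// integralD// integralD//.
have -> : (\int[mu]_(g in SG) a%:E = a%:E)%E by rewrite integral_cst//= muSG mule1.
rewrite integralZl//; last exact: integrable_increment.
rewrite poisson// mule0 adde0.
under eq_integral do rewrite EFinM.
rewrite integralZl//.
rewrite integral_indic// (setIidl GdSG) integralZl//.
rewrite /p /I !EFinD !EFinM !fineK//.
  by apply: integrable_fin_num.
exact: fin_num_measure.
Qed.

Lemma le_integral_majorant (x : E) (a b c e : R) (f : G -> \bar R) : SE x ->
  measurable_fun SG f -> (forall g, SG g -> 0 <= f g)%E ->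
  (forall g, SG g -> f g <= (a + b * increment g x + c * \1_Gd g +
              e * expR (2 * eta * ell g))%:E)%E ->
  (\int[mu]_(g in SG) f g <= (a + c * p + e * I)%:E)%E.
Proof.
move=> xS mf f0 fle.
have [iM <-] := integral_majorant a b c e xS.
apply: ge0_le_integral => //; last exact: measurable_int iM.
Qed.

(** * The killed transition kernel and its iterates *)

Definition step g (z : E * R) : E * R := (act g z.1, z.2 + rho g z.1).

Definition killed (Phi : E * R -> \bar R) (z : E * R) : \bar R :=
  (\int[mu]_(g in SG) if (0 < (step g z).2)%R then Phi (step g z) else 0)%E.

Lemma measurable_step : measurable_fun setT (fun t : G * (E * R) => step t.1 t.2).
Proof.
have m1 : measurable_fun setT (fun t : G * (E * R) => (t.1, t.2.1)).
  apply: measurable_fun_pair => //.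
  exact: (measurableT_comp measurable_fst measurable_snd).
apply: measurable_fun_pair; first exact: (measurableT_comp mact m1).
apply: measurable_funD; last exact: (measurableT_comp mrho m1).
exact: (measurableT_comp measurable_snd measurable_snd).
Qed.

Lemma measurable_killed_integrand (Phi : E * R -> \bar R) :
  measurable_fun setT Phi -> measurable_fun setT (fun t : G * (E * R) =>
    if 0 < (step t.1 t.2).2 then Phi (step t.1 t.2) else 0%E).
Proof.
move=> mPhi; apply: measurable_fun_ifT => //.
  apply: measurable_fun_ltr => //.
  exact: (measurableT_comp measurable_snd measurable_step).
exact: (measurableT_comp mPhi measurable_step).
Qed.

Lemma measurable_killed_integrand1 (Phi : E * R -> \bar R) z :
  measurable_fun setT Phi -> measurable_fun SG (fun g =>
    if (0 < (step g z).2)%R then Phi (step g z) else 0%E).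
Proof.
move=> mPhi; apply: measurable_funTS.
exact: (measurable_fun_pair1 z (measurable_killed_integrand mPhi)).
Qed.

Lemma measurable_killed (Phi : E * R -> \bar R) :
  measurable_fun setT Phi -> measurable_fun setT (killed Phi).
Proof.
move=> mPhi.
exact: (measurable_parametric_integral mu mSG (measurable_killed_integrand mPhi)).
Qed.

Lemma killed_ge0 (Phi : E * R -> \bar R) z : (forall z, 0 <= Phi z)%E ->
  (0 <= killed Phi z)%E.
Proof. by move=> Phi0; apply: integral_ge0 => g _; case: ifP. Qed.

(** From a point of [SE], the kernel charges only points of [SE] at positive height, so the
    comparison is asked for on that half-space alone. *)
Lemma le_killed (Phi Psi : E * R -> \bar R) z :
  measurable_fun setT Phi -> measurable_fun setT Psi ->
  (forall z, 0 <= Phi z)%E ->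
  (forall z : E * R, SE z.1 -> (0 <= z.2)%R -> Phi z <= Psi z)%E -> SE z.1 ->
  (killed Phi z <= killed Psi z)%E.
Proof.
move=> mPhi mPsi Phi0 le zS; apply: ge0_le_integral => //.
- by move=> g _; case: ifP.
- exact: measurable_killed_integrand1.
- exact: measurable_killed_integrand1.
- move=> g gS; case: ifP => // s0; apply: le; last exact: ltW.
  exact: act_stable.
Qed.

Lemma killedD (Phi Psi : E * R -> \bar R) z :
  measurable_fun setT Phi -> measurable_fun setT Psi ->
  (forall z, 0 <= Phi z)%E -> (forall z, 0 <= Psi z)%E ->
  killed (fun z => Phi z + Psi z)%E z = (killed Phi z + killed Psi z)%E.
Proof.
move=> mPhi mPsi Phi0 Psi0; rewrite /killed -ge0_integralD//.
- by apply: eq_integral => g _; case: ifP; rewrite ?adde0.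
- by move=> g _; case: ifP.
- exact: measurable_killed_integrand1.
- by move=> g _; case: ifP.
- exact: measurable_killed_integrand1.
Qed.

Lemma killedZ (Phi : E * R -> \bar R) (c : R) z :
  measurable_fun setT Phi -> (forall z, 0 <= Phi z)%E -> 0 <= c ->
  killed (fun z => c%:E * Phi z)%E z = (c%:E * killed Phi z)%E.
Proof.
move=> mPhi Phi0 c0; rewrite /killed -ge0_integralZl_EFin//.
- by apply: eq_integral => g _; case: ifP; rewrite ?mule0.
- by move=> g _; case: ifP.
- exact: measurable_killed_integrand1.
Qed.

Lemma measurable_iter_killed (Phi : E * R -> \bar R) n :
  measurable_fun setT Phi -> measurable_fun setT (iter n killed Phi).
Proof. by move=> mPhi; elim: n => //= n; exact: measurable_killed. Qed.

Lemma iter_killed_ge0 (Phi : E * R -> \bar R) n z : (forall z, 0 <= Phi z)%E ->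
  (0 <= iter n killed Phi z)%E.
Proof. by move=> Phi0; elim: n z => //= n IH z; exact: killed_ge0. Qed.

Lemma le_iter_killed (Phi Psi : E * R -> \bar R) n z :
  measurable_fun setT Phi -> measurable_fun setT Psi ->
  (forall z, 0 <= Phi z)%E ->
  (forall z : E * R, SE z.1 -> (0 <= z.2)%R -> Phi z <= Psi z)%E -> SE z.1 -> (0 <= z.2)%R ->
  (iter n killed Phi z <= iter n killed Psi z)%E.
Proof.
move=> mPhi mPsi Phi0 le; elim: n z => [z zS z0|n IH z zS z0] /=; first exact: le.
apply: le_killed => //; try exact: measurable_iter_killed.
by move=> y; exact: iter_killed_ge0.
Qed.

Lemma iter_killedD (Phi Psi : E * R -> \bar R) n :
  measurable_fun setT Phi -> measurable_fun setT Psi ->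
  (forall z, 0 <= Phi z)%E -> (forall z, 0 <= Psi z)%E ->
  iter n killed (fun z => Phi z + Psi z)%E =
  (fun z => iter n killed Phi z + iter n killed Psi z)%E.
Proof.
move=> mPhi mPsi Phi0 Psi0; elim: n => //= n ->; apply/funext => z.
by rewrite killedD// => *; [exact: measurable_iter_killed|
  exact: measurable_iter_killed|exact: iter_killed_ge0|exact: iter_killed_ge0].
Qed.

Lemma iter_killedZ (Phi : E * R -> \bar R) (c : R) n :
  measurable_fun setT Phi -> (forall z, 0 <= Phi z)%E -> 0 <= c ->
  iter n killed (fun z => c%:E * Phi z)%E = (fun z => c%:E * iter n killed Phi z)%E.
Proof.
move=> mPhi Phi0 c0; elim: n => //= n ->; apply/funext => z.
by rewrite killedZ// => *; [exact: measurable_iter_killed|exact: iter_killed_ge0].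
Qed.

Definition superharmonic (Phi : E * R -> \bar R) :=
  forall z : E * R, SE z.1 -> (0 <= z.2)%R -> (killed Phi z <= Phi z)%E.

Lemma iter_superharmonic (Phi Psi : E * R -> \bar R) n z :
  measurable_fun setT Phi -> measurable_fun setT Psi ->
  (forall z, 0 <= Phi z)%E -> superharmonic Psi ->
  (forall z : E * R, SE z.1 -> (0 <= z.2)%R -> Phi z <= Psi z)%E ->
  SE z.1 -> (0 <= z.2)%R ->
  (iter n killed Phi z <= Psi z)%E.
Proof.
move=> mPhi mPsi Phi0 sPsi le; elim: n z => [z zS z0|n IH z zS z0] /=; first exact: le.
apply: le_trans (sPsi z zS z0); apply: le_killed => //.
  exact: measurable_iter_killed.
by move=> y; exact: iter_killed_ge0.
Qed.

(** Integrated over [mu], the left side is A + 2 exp(-beta h(x)): the indicator has mass [p], so the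
    factor [2 / p] restores the old weight exp(-beta h(x)) and leaves an equal surplus, which makes
    the submartingale strict. *)
Lemma rising_weight : exists A beta : R, [/\ 0 < A, 0 < beta &
  forall g x, SG g -> SE x ->
    A * (1 - eta * increment g x) + \1_Gd g * (2 / p * expR (- beta * h x))
    <= expR (- eta * increment g x) * (A + expR (- beta * h (act g x)))].
Proof.
pose t0 := eta * delta / 2.
have t00 : 0 < t0 by rewrite /t0 !mulr_gt0 ?invr_gt0.
have k0 := expRN_sub1D_gt0 t00.
(* Chosen so that (beta - eta) delta / 2 = ln(2 / p). *)
pose beta := eta + 2 / delta * ln (2 / p).
have p0 := p_gt0; have p1 := p_le1.
have lnp0 : 0 <= ln (2 / p) by rewrite ln_ge0// ler_pdivlMr// mul1r; lra.
have eb : eta <= beta.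
  by rewrite /beta lerDl mulr_ge0// divr_ge0 ?ltW.
have beta0 : 0 < beta by rewrite (lt_le_trans eta_gt0).
(* Chosen so that A times the convexity gap at [t0] is (2 / p) exp(beta B), the largest value of the
   term to be gained. *)
pose A := 2 / p * expR (beta * B) / (expR (- t0) - 1 + t0).
have A0 : 0 < A by rewrite /A !mulr_gt0 ?invr_gt0 ?expR_gt0.
exists A, beta; split => // g x gS xS.
set D := increment g x.
have expD : 1 - eta * D <= expR (- eta * D).
  by have := expR_ge1Dx (- eta * D); rewrite mulNr.
have v0 := expR_gt0 (- beta * h (act g x)).
have ED := expR_gt0 (- eta * D).
have AexpD : A * (1 - eta * D) <= A * expR (- eta * D) by rewrite ler_pM2l.
rewrite [leRHS]mulrDr (mulrC _ A).
rewrite indicE; case: (boolP (g \in Gd)) => [|_] /=; last first.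
  by rewrite mul0r addr0 (le_trans AexpD)// lerDl mulr_ge0// ltW.
rewrite inE mul1r => gGd.
have hx : expR (- beta * h x) <= expR (beta * B).
  rewrite ler_expR; have := hB x; rewrite ler_norml => /andP[? _]; nra.
(* If D <= delta / 2, then rho >= delta forces h to drop by at least delta / 2 and the growth of
   exp(-beta h) pays; otherwise the convexity gap at eta D does. *)
have [Dle|Dgt] := leP D (delta / 2).
  apply: lerD => //; rewrite -expRD -[2 / p]lnK; last first.
    by rewrite posrE divr_gt0.
  rewrite -expRD ler_expR.
  have := rho_delta gGd xS; rewrite (_ : rho g x = D - h (act g x) + h x); last first.
    by rewrite /D /increment; ring.
  have -> : ln (2 / p) = (beta - eta) * delta / 2.
    by rewrite /beta; field; rewrite !gt_eqF.
  move: (h (act g x)) => h1 dD.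
  have : 0 <= beta * (D - h1 + h x - delta) by rewrite mulr_ge0 ?subr_ge0// ltW.
  have : 0 <= (eta + beta) * (delta / 2 - D) by rewrite mulr_ge0 ?subr_ge0// addr_ge0 ?ltW.
  by lra.
have kD : A * (expR (- t0) - 1 + t0) <= A * (expR (- (eta * D)) - 1 + eta * D).
  rewrite ler_pM2l// ler_expRN_sub1D//; first exact: ltW.
  by rewrite /t0 -mulrA ler_pM2l// ltW.
have Ak : A * (expR (- t0) - 1 + t0) = 2 / p * expR (beta * B).
  by rewrite /A divfK// gt_eqF.
have : 2 / p * expR (- beta * h x) <= 2 / p * expR (beta * B).
  by rewrite ler_pM2l// divr_gt0.
rewrite mulNr in ED *; have : 0 < expR (- (eta * D)) * expR (- beta * h (act g x)).
  by rewrite mulr_gt0.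
lra.
Qed.

(** The witness is K - F, where F is the weighted exponential of y = s + h(x), set to 0 below -L so
    that K bounds it. Killing only helps because K - F >= 0. Summing the inequality over the
    iterates bounds the Green function of exp(-eta s) by K / kappa. *)
Lemma green_potential : exists (H : E * R -> R) (K kappa : R),
  [/\ 0 < kappa, measurable_fun setT H, (forall z, 0 <= H z <= K) &
   forall z : E * R, SE z.1 -> (0 <= z.2)%R ->
     (killed (EFin \o H) z <= (H z - kappa * expR (- eta * z.2))%:E)%E].
Proof.
have [A [beta [A0 beta0 rising]]] := rising_weight.
have p0 := p_gt0; have B0 := B_ge0.
pose v x := A + expR (- beta * h x).
pose U := A + expR (beta * B).
have v0 x : 0 < v x by rewrite addr_gt0// expR_gt0.
have vU x : v x <= U.
  rewrite lerD2l ler_expR; have := hB x; rewrite ler_norml => /andP[? _]; nra.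
have U0 : 0 < U by rewrite addr_gt0// expR_gt0.
have I0 : 0 <= I.
  by apply: fine_ge0; apply: integral_ge0 => g _; rewrite lee_fin expR_ge0.
(* The surplus of [rising_weight] is at least 2 kappa exp(-eta s); half of it is kept, the other
   half pays for the truncation. *)
pose kappa := expR (- (eta + beta) * B) / 2.
have kappa0 : 0 < kappa by rewrite divr_gt0 ?expR_gt0.
pose c := U * expR (2 * eta * B) * I.
have c0 : 0 <= c by rewrite !mulr_ge0 ?expR_ge0// ltW.
(* The term B keeps every point of non-negative height out of the truncated zone; the other one
   brings the truncation cost c exp(-eta L) below [kappa], by 1 + t <= exp t. *)
pose L := B + c / (kappa * eta).
have BL : B <= L by rewrite lerDl divr_ge0// mulr_ge0 ?ltW.
have cL : c * expR (- eta * L) <= kappa.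
  rewrite mulNr expRN ler_pdivrMr ?expR_gt0//.
  apply: (@le_trans _ _ (kappa * (1 + eta * L))); last first.
    by rewrite ler_pM2l// expR_ge1Dx.
  apply: (@le_trans _ _ (kappa * (eta * (c / (kappa * eta))))).
    by rewrite le_eqVlt; apply/orP; left; apply/eqP; field; rewrite !gt_eqF.
  rewrite ler_pM2l// /L mulrDr; have := mulr_ge0 (ltW eta_gt0) B0; lra.
pose y (z : E * R) := z.2 + h z.1.
pose F z := v z.1 * expR (- eta * y z) * (- L <= y z)%R%:R.
pose K := U * expR (eta * L).
have F0 z : 0 <= F z by rewrite !mulr_ge0 ?ler0n ?expR_ge0// ltW.
have FK z : F z <= K.
  rewrite /F; case: (leP (- L) (y z)) => yL; last first.
    by rewrite mulr0 mulr_ge0 ?expR_ge0// ltW.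
  rewrite mulr1 ler_pM ?expR_ge0 ?ler_expR//; first exact: ltW.
  by rewrite mulNr -mulrN ler_pM2l// lerNl.
have my : measurable_fun setT y.
  by apply: measurable_funD => //; exact: (measurableT_comp mh measurable_fst).
have mF : measurable_fun setT F.
  apply: measurable_funM; first apply: measurable_funM.
  - apply: measurable_funD => //; apply: measurableT_comp => //.
    apply: measurable_funM => //; exact: (measurableT_comp mh measurable_fst).
  - by apply: measurableT_comp => //; exact: measurable_funM.
  - rewrite (_ : (fun x => _) = (fun z => if - L <= y z then 1 else 0)); last first.
      by apply/funext => z; case: (_ <= _).
    by apply: measurable_fun_ifT => //; exact: measurable_fun_ler.
have mH : measurable_fun setT (fun z => K - F z) by exact: measurable_funB.
exists (fun z => K - F z), K, kappa; split => //.
  by move=> z; rewrite subr_ge0 FK/= lerBlDr lerDl.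
move=> z zS z0; set x := z.1 in zS *; set s := z.2 in z0 *.
pose e0 := expR (- eta * y z).
have e00 : 0 < e0 := expR_gt0 _.
pose C1 := 2 / p * expR (- beta * h x).
apply: le_trans (le_integral_majorant (x := x) (a := K - e0 * A)
  (b := e0 * A * eta) (c := - e0 * C1)
  (e := U * expR (2 * eta * B) * expR (- eta * L) * expR (- eta * s)) _ _ _ _) _.
- exact: zS.
- by apply: measurable_killed_integrand1; exact/measurable_EFinP.
- by move=> g gS; case: ifP => // _; rewrite lee_fin subr_ge0.
- move=> g gS; apply: (@le_trans _ _ (K - F (step g z))%:E).
    by case: ifP => // _; rewrite lee_fin subr_ge0.
  rewrite lee_fin; set z1 := step g z.
  have y1E : y z1 = y z + increment g x by rewrite /y /z1 /step/= /increment/=; ring.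
  (* Where y < -L, a factor exp(-eta (y + L)) >= 1 is inserted; as y >= s - ell - B, this doubles
     the exponent of ell to 2 eta and yields the small factor exp(-eta L). *)
  have F1 : v z1.1 * expR (- eta * y z1) -
      U * expR (2 * eta * B) * expR (- eta * L) * expR (- eta * s) *
      expR (2 * eta * ell g) <= F z1.
    rewrite /F; case: (leP (- L) (y z1)) => yL; rewrite ?mulr1 ?mulr0.
      by rewrite gerBl !mulr_ge0 ?expR_ge0// ltW.
    rewrite subr_le0 -!mulrA -!expRD; apply: ler_pM.
    - exact: ltW.
    - exact: expR_ge0.
    - exact: vU.
    rewrite ler_expR.
    have := rho_ell gS zS; rewrite ler_norml => /andP[r1 _].
    have := hB z1.1; rewrite ler_norml => /andP[h1 _].
    have : y z1 = s + rho g x + h z1.1 by [].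
    move: (y z1) (h z1.1) (rho g x) (ell g) yL h1 r1 => yy hh rr ee yL h1 r1 yE.
    have : 0 <= eta * (2 * B - L - s + 2 * ee + yy).
      by rewrite mulr_ge0 ?(ltW eta_gt0)//; lra.
    by lra.
  have v1 : e0 * (A * (1 - eta * increment g x) + \1_Gd g * C1) <=
      v z1.1 * expR (- eta * y z1).
    rewrite y1E (mulrDr (- eta)) expRD [leRHS]mulrCA -/e0 ler_pM2l//.
    by rewrite [leRHS]mulrC; exact: rising.
  lra.
- rewrite lee_fin.
  have -> : F z = v x * e0.
    rewrite /F (_ : - L <= y z) ?mulr1//.
    have := hB x; rewrite ler_norml => /andP[? _]; rewrite /y -/x -/s; lra.
  have -> : - e0 * C1 * p = - e0 * (2 * expR (- beta * h x)).
    by rewrite /C1; field; rewrite gt_eqF.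
  have e0s : expR (- eta * B) * expR (- eta * s) <= e0.
    rewrite -expRD ler_expR; have := hB x; rewrite ler_norml => /andP[_].
    by move=> /(ler_wpM2l (ltW eta_gt0)); rewrite /y -/x -/s; lra.
  have bB : expR (- beta * B) <= expR (- beta * h x).
    rewrite ler_expR; have := hB x; rewrite ler_norml => /andP[_ ?]; nra.
  have k2 : kappa * 2 = expR (- eta * B) * expR (- beta * B).
    by rewrite /kappa divfK// -expRD; congr expR; ring.
  have cs : U * expR (2 * eta * B) * expR (- eta * L) * expR (- eta * s) * I <=
      kappa * expR (- eta * s).
    rewrite [leLHS](_ : _ = c * expR (- eta * L) * expR (- eta * s)); last first.
      by rewrite /c; ring.
    by rewrite ler_pM2r ?expR_gt0.
  have : kappa * 2 * expR (- eta * s) <= e0 * expR (- beta * h x).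
    rewrite k2 mulrAC; by apply: ler_pM => //; rewrite ?mulr_ge0 ?expR_ge0.
  rewrite /v; lra.
Qed.

(** * A superharmonic majorant of the height *)

Definition height (z : E * R) : R := `|z.2| + h z.1 + B.

Lemma measurable_height : measurable_fun setT height.
Proof.
apply: measurable_funD => //; apply: measurable_funD.
  exact: (measurableT_comp (@normr_measurable R setT) measurable_snd).
exact: (measurableT_comp mh measurable_fst).
Qed.

Lemma height_bounds z : `|z.2| <= height z <= `|z.2| + 2 * B.
Proof.
have := hB z.1; rewrite ler_norml => /andP[? ?].
by rewrite /height; apply/andP; split; lra.
Qed.

Lemma I_ge0 : 0 <= I.
Proof.
by apply: fine_ge0; apply: integral_ge0 => g _; rewrite lee_fin expR_ge0.
Qed.

(** Without killing, s1 + h(x1) + B has mean [height z]. Killing discards it when s1 <= 0, and its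
    negative part is then at most ell; moreover s <= ell there, so that ell <= exp(eta ell) / eta <=
    exp(2 eta ell - eta s) / eta. *)
Lemma overshoot (z : E * R) : SE z.1 -> (0 <= z.2)%R ->
  (killed (EFin \o height) z <=
   (height z + I / eta * expR (- eta * z.2))%:E)%E.
Proof.
move=> zS z0.
apply: le_trans (le_integral_majorant (x := z.1) (a := height z) (b := 1)
  (c := 0) (e := eta^-1 * expR (- eta * z.2)) _ _ _ _) _.
- exact: zS.
- by apply: measurable_killed_integrand1; apply/measurable_EFinP; exact: measurable_height.
- move=> g gS; case: ifP => // _; rewrite lee_fin.
  by have /andP[+ _] := height_bounds (step g z); apply: le_trans.
- move=> g gS.
  have e0 : 0 <= eta^-1 * expR (- eta * z.2) * expR (2 * eta * ell g).
    by rewrite !mulr_ge0 ?expR_ge0// invr_ge0 ltW.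
  have hE : height z + increment g z.1 = (step g z).2 + h (step g z).1 + B.
    by rewrite /height /increment /step/= (ger0_norm z0); ring.
  case: ifPn => s1; rewrite lee_fin mul1r mul0r addr0 hE.
    by rewrite /height gtr0_norm// lerDl.
  rewrite -leNgt in s1; rewrite -(mulrA eta^-1) -expRD.
  have := hB (step g z).1; rewrite ler_norml => /andP[h1 _].
  have := rho_ell gS zS; rewrite ler_norml => /andP[r1 _].
  have zl : z.2 <= ell g by move: s1; rewrite /step/=; lra.
  have : eta * ell g <= expR (- eta * z.2 + 2 * eta * ell g).
    apply: (@le_trans _ _ (expR (eta * ell g))).
      by rewrite (le_trans _ (expR_ge1Dx _))// lerDr.
    rewrite ler_expR; have := ler_wpM2l (ltW eta_gt0) zl; lra.
  move=> /(ler_wpM2l (ltW (_ : 0 < eta^-1))).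
  rewrite invr_gt0 => /(_ eta_gt0); rewrite mulKf ?gt_eqF//.
  move: h1 s1; rewrite /step/=; lra.
- by rewrite mul0r addr0 lee_fin lerD2l; rewrite le_eqVlt; apply/orP; left; apply/eqP; ring.
Qed.

Lemma superharmonic_majorant : exists (W : E * R -> R) (C : R),
  [/\ measurable_fun setT W, 0 <= C, (forall z, height z <= W z),
      (forall z, W z <= `|z.2| + C) & superharmonic (EFin \o W)].
Proof.
have [H [K [kappa [kappa0 mH HK killH]]]] := green_potential.
(* Times [C1], the drift -kappa exp(-eta s) of [H] cancels the overshoot exactly. *)
pose C1 := I / eta / kappa.
have C10 : 0 <= C1 by rewrite !divr_ge0 ?I_ge0// ltW.
have H0 z : 0 <= H z by have /andP[] := HK z.
have K0 : 0 <= K by case: SE0 => x _; have /andP[] := HK (x, 0); exact: le_trans.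
have hh0 z : 0 <= height z by have /andP[+ _] := height_bounds z; apply: le_trans.
have mheight := measurable_height.
exists (fun z => height z + C1 * H z), (2 * B + C1 * K); split.
- by apply: measurable_funD => //; exact: measurable_funM.
- by have B0 := B_ge0; apply: addr_ge0; apply: mulr_ge0.
- by move=> z; rewrite lerDl mulr_ge0.
- move=> z; have /andP[_ ?] := height_bounds z; have /andP[_ ?] := HK z.
  by rewrite addrA lerD// ler_wpM2l.
move=> z zS z0.
have mhE : measurable_fun setT (EFin \o height) by exact/measurable_EFinP.
have mHE : measurable_fun setT (EFin \o H) by exact/measurable_EFinP.
have hE0 y : (0 <= (EFin \o height) y)%E by rewrite /= lee_fin.
have HE0 y : (0 <= (EFin \o H) y)%E by rewrite /= lee_fin.
have mCH : measurable_fun setT (fun y => C1%:E * (EFin \o H) y)%E.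
  exact: emeasurable_funM.
have CH0 y : (0 <= C1%:E * (EFin \o H) y)%E by rewrite mule_ge0// lee_fin.
rewrite (_ : EFin \o _ = fun z => ((EFin \o height) z + C1%:E * (EFin \o H) z)%E)//.
rewrite (killedD _ mhE mCH hE0 CH0) (killedZ _ mHE HE0 C10).
apply: le_trans (leeD (overshoot zS z0) _) _.
  by apply: lee_wpmul2l; [rewrite lee_fin|exact: killH].
rewrite -EFinM -EFinD lee_fin le_eqVlt; apply/orP; left; apply/eqP.
by rewrite /C1; field; rewrite !gt_eqF.
Qed.

Definition height0 : E * R -> \bar R := fun z => `|z.2|%:E.

Lemma measurable_height0 : measurable_fun setT height0.
Proof.
apply/measurable_EFinP.
exact: (measurableT_comp (@normr_measurable R setT) measurable_snd).
Qed.

Lemma iter_killed_height_bound : exists2 C : R, 0 <= C &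
  forall n (z : E * R), SE z.1 -> (0 <= z.2)%R ->
    (iter n killed (EFin \o height) z <= (z.2 + C)%:E)%E.
Proof.
have [W [C [mW C0 hW WC sW]]] := superharmonic_majorant.
exists C => // n z zS z0.
apply: le_trans (iter_superharmonic (Psi := EFin \o W) _ _ _ _ sW _ _ _) _ => //.
- by apply/measurable_EFinP; exact: measurable_height.
- exact/measurable_EFinP.
- by move=> y; rewrite lee_fin; have /andP[+ _] := height_bounds y; apply: le_trans.
- by move=> y _ _; rewrite /= lee_fin.
- by rewrite /= lee_fin -(ger0_norm z0).
Qed.

Lemma iter_killed_height0_bound : exists2 C : R, 0 <= C &
  forall n (z : E * R), SE z.1 -> (0 <= z.2)%R ->
    (iter n killed height0 z <= (z.2 + C)%:E)%E.
Proof.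
have [C C0 hC] := iter_killed_height_bound.
exists C => // n z zS z0; apply: le_trans (hC n z zS z0).
apply: le_iter_killed => //.
- exact: measurable_height0.
- by apply/measurable_EFinP; exact: measurable_height.
- by move=> y; rewrite lee_fin.
- by move=> y _ _; rewrite lee_fin; have /andP[] := height_bounds y.
Qed.

(** The terms of a convergent series tend to 0: the induction [main] telescopes the drift inequality
    of [H] and bounds the Green sum by H / kappa. *)
Lemma green_cvg0 (z : E * R) : SE z.1 -> (0 <= z.2)%R -> forall e : R, 0 < e ->
  \forall n \near \oo,
    (iter n killed (fun y => (expR (- eta * y.2))%:E) z <= e%:E)%E.
Proof.
move=> zS z0.
have [H [K [kappa [kappa0 mH HK killH]]]] := green_potential.
set Gr := fun y : E * R => (expR (- eta * y.2))%:E.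
have H0 y : 0 <= H y by have /andP[] := HK y.
have mHE : measurable_fun setT (EFin \o H) by exact/measurable_EFinP.
have mGr : measurable_fun setT Gr.
  apply/measurable_EFinP; apply: measurableT_comp => //.
  by apply: measurable_funM.
have Gr0 y : (0 <= Gr y)%E by rewrite lee_fin expR_ge0.
have HE0 y : (0 <= (EFin \o H) y)%E by rewrite /= lee_fin.
have main n : (iter n killed (EFin \o H) z +
    kappa%:E * \sum_(0 <= k < n) iter k killed Gr z <= (H z)%:E)%E.
  elim: n => [|n IH]; first by rewrite big_geq// mule0 adde0.
  apply: le_trans IH; rewrite big_nat_recr//= ge0_muleDr; last 2 first.
  - by apply: sume_ge0 => k _; exact: iter_killed_ge0.
  - exact: iter_killed_ge0.
  rewrite addeCA [leRHS]addeC leeD2l// -iterS iterSr.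
  rewrite -[X in (_ + X <= _)%E]/((fun y => kappa%:E * iter n killed Gr y)%E z).
  rewrite -iter_killedZ//; last exact: ltW.
  rewrite -[leLHS]/((fun y => iter n killed (killed (EFin \o H)) y +
    iter n killed (fun y => kappa%:E * Gr y) y)%E z).
  rewrite -iter_killedD//; last 4 first.
  - exact: measurable_killed.
  - exact: emeasurable_funM.
  - by move=> y; exact: killed_ge0.
  - by move=> y; rewrite mule_ge0// lee_fin ltW.
  apply: le_iter_killed => //.
  - by apply: emeasurable_funD; [exact: measurable_killed|exact: emeasurable_funM].
  - by move=> y; rewrite adde_ge0 ?killed_ge0// mule_ge0// lee_fin ltW.
  - move=> y yS y0; rewrite -EFinM; apply: le_trans (leeD2r _ (killH _ yS y0)) _.
    by rewrite -EFinD lee_fin subrK.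
pose u n := fine (iter n killed Gr z).
have ufin n : iter n killed Gr z \is a fin_num.
  have := main n.+1; rewrite big_nat_recr//= => le1.
  rewrite ge0_fin_numE ?iter_killed_ge0//.
  apply: (@le_lt_trans _ _ (kappa^-1 * H z)%:E); last exact: ltry.
  rewrite EFinM -[leLHS]mul1e -(mulVf (lt0r_neq0 kappa0)) EFinM -muleA.
  apply: lee_wpmul2l; first by rewrite lee_fin invr_ge0 ltW.
  apply: le_trans le1; rewrite ge0_muleDr ?sume_ge0// => *; rewrite ?iter_killed_ge0//.
  rewrite addeA; apply: leeDr; rewrite adde_ge0 ?killed_ge0//.
    by move=> *; exact: iter_killed_ge0.
  by rewrite mule_ge0 ?lee_fin ?(ltW kappa0)// sume_ge0// => *; exact: iter_killed_ge0.
have u0 n : 0 <= u n by rewrite fine_ge0// iter_killed_ge0.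
have ub n : series u n <= H z / kappa.
  rewrite ler_pdivlMr// mulrC -lee_fin EFinM /series/= -sumEFin.
  under eq_bigr do rewrite /u fineK//.
  by apply: le_trans (main n); rewrite leeDr// iter_killed_ge0.
have cu : cvgn (series u).
  apply: nondecreasing_is_cvgn.
    by apply/nondecreasing_seqP => n; rewrite !seriesEnat/= big_nat_recr//= lerDl.
  by exists (H z / kappa) => _ [n _ <-].
have := cvg_series_cvg_0 cu => /cvgrPdist_le cu0 e e0.
have := cu0 _ e0; apply: filterS => n; rewrite sub0r normrN ger0_norm// => ue.
by rewrite -(fineK (ufin n)) lee_fin.
Qed.

(** For s >= 0, 1 <= exp(eta L) exp(-eta s) + s / L, according to whether s <= L or not. Low
    positions are excluded by the Green function, high ones by the bound on the mean height, with L
    taken so large that the latter contributes at most e / 2. *)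
Lemma survival_cvg0 (z : E * R) : SE z.1 -> (0 <= z.2)%R -> forall e : R, 0 < e ->
  \forall n \near \oo, (iter n killed (fun=> 1%E) z <= e%:E)%E.
Proof.
move=> zS z0 e e0.
have [C C0 hC] := iter_killed_height0_bound.
pose L := 2 * (z.2 + C + 1) / e.
have L0 : 0 < L by rewrite divr_gt0// mulr_gt0//; lra.
have q0 : 0 < e / 2 / expR (eta * L) by rewrite !divr_gt0 ?expR_gt0.
have := green_cvg0 zS z0 q0; apply: filterS => n gn.
set Gr := fun y : E * R => (expR (- eta * y.2))%:E.
have mGr : measurable_fun setT Gr.
  apply/measurable_EFinP; apply: measurableT_comp => //.
  by apply: measurable_funM.
have Gr0 y : (0 <= Gr y)%E by rewrite lee_fin expR_ge0.
have mh0 := measurable_height0.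
apply: (@le_trans _ _ (iter n killed (fun y => (expR (eta * L))%:E * Gr y +
    (L^-1)%:E * height0 y)%E z)).
  apply: le_iter_killed => //.
  - by apply: emeasurable_funD; exact: emeasurable_funM.
  move=> y _ y0; rewrite -!EFinM -EFinD lee_fin ger0_norm// -expRD.
  have [yL|Ly] := leP y.2 L.
    rewrite (@le_trans _ _ (expR (eta * L + - eta * y.2)))//.
      rewrite -[leLHS]expR0 ler_expR mulNr -mulrBr mulr_ge0 ?subr_ge0//.
      exact: ltW.
    by rewrite lerDl mulr_ge0// invr_ge0 ltW.
  rewrite (@le_trans _ _ (L^-1 * y.2))// ?lerDr ?expR_ge0//.
  by rewrite mulrC ler_pdivlMr// mul1r ltW.
rewrite iter_killedD//; last 4 first.
- exact: emeasurable_funM.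
- exact: emeasurable_funM.
- by move=> y; rewrite mule_ge0// lee_fin expR_ge0.
- by move=> y; rewrite mule_ge0// lee_fin ?invr_ge0// ltW.
rewrite iter_killedZ ?expR_ge0// iter_killedZ//; last by rewrite invr_ge0 ltW.
apply: le_trans (leeD (lee_wpmul2l _ gn) (lee_wpmul2l _ (hC n z zS z0))) _.
- by rewrite lee_fin expR_ge0.
- by rewrite lee_fin invr_ge0 ltW.
rewrite -!EFinM -EFinD lee_fin mulrC divfK ?gt_eqF ?expR_gt0//.
have : L^-1 * (z.2 + C) <= e / 2.
  rewrite mulrC ler_pdivrMr// (_ : e / 2 * L = z.2 + C + 1) ?lerDl//.
  by rewrite /L; field; rewrite gt_eqF.
lra.
by move=> y; rewrite lee_fin.
Qed.

(** * Mean height of the surviving walk and the renewal function *)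

Definition killed_mean n (z : E * R) : \bar R := iter n killed height0 z.

Lemma height0_ge0 (z : E * R) : (0 <= height0 z)%E.
Proof. by rewrite lee_fin. Qed.

Lemma killed_mean_ge0 n z : (0 <= killed_mean n z)%E.
Proof. by apply: iter_killed_ge0 => y; exact: height0_ge0. Qed.

Lemma measurable_killed_mean n : measurable_fun setT (killed_mean n).
Proof. by apply: measurable_iter_killed; exact: measurable_height0. Qed.

(** Coupling: started higher and driven by the same matrices, the walk stays higher and survives at
    least as long. *)
Lemma killed_mean_nondecreasing n x (a b : R) : SE x -> 0 <= a -> a <= b ->
  (killed_mean n (x, a) <= killed_mean n (x, b))%E.
Proof.
elim: n x a b => [|n IH] x a b xS a0 ab.
  by rewrite lee_fin !ger0_norm// (le_trans a0).
apply: ge0_le_integral => //=.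
- by move=> g _; case: ifP => // _; exact: killed_mean_ge0.
- by apply: (measurable_killed_integrand1 (x, a)); exact: measurable_killed_mean.
- by apply: (measurable_killed_integrand1 (x, b)); exact: measurable_killed_mean.
move=> g gS; case: ifP => [s0|_]; last by case: ifP => // _; exact: killed_mean_ge0.
rewrite (lt_le_trans s0) ?lerD2r//; apply: IH; rewrite ?lerD2r//.
  exact: act_stable.
exact: ltW.
Qed.

(** A superior limit is measurable and defined at every point; that it is a limit is shown only on
    [SE] at non-negative heights. *)
Definition renewal (z : E * R) : \bar R := limn_esup (killed_mean^~ z).

Lemma measurable_renewal : measurable_fun setT renewal.
Proof. by apply: measurable_fun_limn_esup => n; exact: measurable_killed_mean. Qed.

(** * Sample paths of the killed walk *)

Section walk_path.
Context {dO : measure_display} {Omega : measurableType dO}.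
Context (P : probability Omega R) (xi : nat -> Omega -> G).
Hypotheses (hxi : iid_seq mu P xi) (xiS : forall n w, SG (xi n w)).
Variable z : E * R.
Local Notation past n := (g_sigma_algebraType (cylinders xi n)).

Fixpoint walk_path n w : E * R := if n is k.+1 then step (xi k w) (walk_path k w) else z.

(** Only times 1, ..., n are tested, so a walk started at height 0 is alive at time 0. *)
Fixpoint alive n w : bool :=
  if n is k.+1 then alive k w && (0 < (walk_path k.+1 w).2) else true.

Lemma path_SE n w : SE z.1 -> SE (walk_path n w).1.
Proof. by move=> zS; elim: n => //= n; exact: act_stable. Qed.

Lemma alive_ge0 n w : 0 <= z.2 -> alive n w -> 0 <= (walk_path n w).2.
Proof. by case: n => //= n _ /andP[_ /ltW]. Qed.

Lemma alive_le m n w : (m <= n)%N -> alive n w -> alive m w.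
Proof.
move=> /subnK <-; elim: (n - m)%N => //= k IH /andP[+ _].
exact: IH.
Qed.

Lemma measurable_path_past n k : (k <= n)%N ->
  measurable_fun setT (walk_path k : past n -> E * R).
Proof.
elim: k => [_|k IH kn] /=; first exact: measurable_cst.
apply: (measurableT_comp measurable_step (g := fun w : past n => (xi k w, walk_path k w))).
apply: measurable_fun_pair; first exact: measurable_xi_past.
by apply: IH; exact: ltnW.
Qed.

Lemma measurable_alive_past n k : (k <= n)%N ->
  measurable_fun setT (alive k : past n -> bool).
Proof.
elim: k => [_|k IH kn] /=; first exact: measurable_cst.
apply: measurable_and; first by apply: IH; exact: ltnW.
apply: measurable_fun_ltr => //.
exact: (measurableT_comp measurable_snd (measurable_path_past kn)).
Qed.

Lemma measurable_path n : measurable_fun setT (walk_path n).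
Proof.
by apply: (measurable_of_past hxi (n := n)); exact: measurable_path_past.
Qed.

Lemma measurable_alive n : measurable_fun setT (alive n).
Proof.
by apply: (measurable_of_past hxi (n := n)); exact: measurable_alive_past.
Qed.

(** The induction is on all [Phi] at once and peels off the last step: given the past, averaging
    over [xi n] turns [Phi] into [killed Phi]. *)
Lemma integral_alive n (Phi : E * R -> \bar R) :
  measurable_fun setT Phi -> (forall z, 0 <= Phi z)%E ->
  (\int[P]_w (if alive n w then Phi (walk_path n w) else 0) = iter n killed Phi z)%E.
Proof.
elim: n Phi => [|n IH] Phi mPhi Phi0.
  by rewrite /= integral_cst//= probability_setT mule1.
rewrite iterSr -IH; last 2 first.
- exact: measurable_killed.
- by move=> y; exact: killed_ge0.
pose f (t : G * past n) := if alive n t.2 then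
  (if 0 < (step t.1 (walk_path n t.2)).2 then Phi (step t.1 (walk_path n t.2)) else 0%E) else 0%E.
have mf : measurable_fun setT f.
  apply: measurable_fun_ifT => //.
    exact: (measurableT_comp (measurable_alive_past (leqnn n)) measurable_snd).
  have mp : measurable_fun setT (fun t : G * past n => (t.1, walk_path n t.2)).
    apply: measurable_fun_pair => //.
    exact: (measurableT_comp (measurable_path_past (leqnn n)) measurable_snd).
  exact: (measurableT_comp (measurable_killed_integrand mPhi) mp).
have f0 g w : SG g -> (0 <= f (g, w))%E by rewrite /f /=; case: ifP => // _; case: ifP.
transitivity (\int[P]_w f (xi n w, w))%E.
  by apply: eq_integral => w _; rewrite /f /=; case: (alive n w).
rewrite (ge0_indep_integral hxi mSG (xiS n) mf f0).
apply: eq_integral => w _; rewrite /f /=; case: (alive n w) => //.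
exact: integral0.
Qed.

(** The martingale stopped at the killing time: [alive k] depends on [xi 0], ..., [xi k.-1] only, so
    each term has mean 0. *)
Definition stopped_martingale n w : R :=
  z.2 + \sum_(k < n) if alive k w then increment (xi k w) (walk_path k w).1 else 0.

Lemma integral_stopped_martingale n : SE z.1 ->
  P.-integrable setT (fun w => (stopped_martingale n w)%:E) /\
  (\int[P]_w (stopped_martingale n w)%:E = z.2%:E)%E.
Proof.
move=> zS; elim: n => [|n [IHi IHe]].
  have -> : stopped_martingale 0 = cst z.2.
    by apply/funext => w; rewrite /stopped_martingale big_ord0 addr0.
  split; first exact: finite_measure_integrable_cst.
  transitivity (\int[P]_w (cst z.2%:E w))%E => //.
  by rewrite integral_cst//= probability_setT mule1.
pose f (t : G * past n) := if alive n t.2 then increment t.1 (walk_path n t.2).1 else 0.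
have mf : measurable_fun setT f.
  apply: measurable_fun_ifT => //.
    exact: (measurableT_comp (measurable_alive_past (leqnn n)) measurable_snd).
  have mp : measurable_fun setT (fun t : G * past n => (walk_path n t.2).1).
    apply: (measurableT_comp measurable_fst).
    exact: (measurableT_comp (measurable_path_past (leqnn n)) measurable_snd).
  have mp1 : measurable_fun setT (fun t : G * past n => (t.1, (walk_path n t.2).1)).
    exact: measurable_fun_pair.
  apply: measurable_funB; last exact: (measurableT_comp mh mp).
  apply: measurable_funD; first exact: (measurableT_comp mrho mp1).
  exact: (measurableT_comp mh (measurableT_comp mact mp1)).
have fk g w : SG g -> `|f (g, w)| <= ell g + 2 * B.
  move=> gS; rewrite /f /=; case: ifP => _; last first.
    by rewrite normr0 addr_ge0 ?ell_ge0// mulr_ge0// B_ge0.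
  by apply: increment_le => //; exact: path_SE.
have [i1 e1] := indep_integral hxi mSG (xiS n) mf (integrable_ellD (2 * B)) fk.
have e2 : (\int[P]_w (f (xi n w, w))%:E = 0)%E.
  rewrite e1; apply: integral0_eq => w _; rewrite /f /=; case: (alive n w).
    by apply: poisson; exact: path_SE.
  exact: integral0.
have sE w : (stopped_martingale n.+1 w)%:E =
    ((stopped_martingale n w)%:E + (f (xi n w, w))%:E)%E.
  by rewrite /stopped_martingale big_ord_recr /= addrA EFinD.
split.
  by under eq_fun do rewrite sE; exact: integrableD.
by under eq_integral do rewrite sE; rewrite integralD// IHe e2 adde0.
Qed.

Definition martingale n w : R := (walk_path n w).2 + h (walk_path n w).1 - h z.1.

Lemma martingaleS n w :
  martingale n.+1 w = martingale n w + increment (xi n w) (walk_path n w).1.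
Proof. by rewrite /martingale /increment /=; ring. Qed.

(** * Stopping at the killing time *)

Section stopping.
Variable Mtau : Omega -> R.
Hypothesis Mtau_stop : forall n w, alive n w -> ~~ alive n.+1 w ->
  Mtau w = martingale n.+1 w.
Hypothesis Mtau_alive : forall w, (forall n, alive n w) -> Mtau w = 0.
Hypotheses (zS : SE z.1) (z0 : 0 <= z.2).

(** [Mtau] is left abstract, fixed only by its values on killed and on surviving paths, so that it
    can be taken as [M_tau] or as a value built from [alive]. *)
Lemma stopped_martingaleE n w :
  stopped_martingale n w = if alive n w then martingale n w else Mtau w.
Proof.
elim: n => [|n IH].
  by rewrite /stopped_martingale big_ord0 addr0 /martingale /=; ring.
rewrite /stopped_martingale big_ord_recr/= addrA -/(stopped_martingale n w) IH.
case: (boolP (alive n w)) => an; last by rewrite addr0.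
rewrite -martingaleS /=; case: (boolP (0 < _)) => //= s0.
by rewrite (Mtau_stop an)// /= an.
Qed.

Let stopped n w : R := if alive n w then 0 else Mtau w.
Let height_alive n w : R := if alive n w then (walk_path n w).2 else 0.
Let error n w : R := if alive n w then h z.1 - h (walk_path n w).1 else 0.

(** On survival the martingale is the height plus h(X_n) - h(x): the identity costs an error of at
    most 2 B, carried by the surviving event. *)
Let stoppedE n w : stopped n w = stopped_martingale n w - height_alive n w + error n w.
Proof.
rewrite stopped_martingaleE /stopped /height_alive /error /martingale.
by case: ifP => _; ring.
Qed.

Let killed_mean_fin n : killed_mean n z \is a fin_num.
Proof.
have [C _ hC] := iter_killed_height0_bound.
rewrite ge0_fin_numE ?killed_mean_ge0//.
exact: le_lt_trans (hC n z zS z0) (ltry _).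
Qed.

Lemma integral_height_alive n :
  (\int[P]_w (if alive n w then (walk_path n w).2 else 0)%:E = killed_mean n z)%E.
Proof.
rewrite /killed_mean -integral_alive; [|exact: measurable_height0|exact: height0_ge0].
apply: eq_integral => w _; case: ifP => // an.
by rewrite /height0 ger0_norm// (alive_ge0 z0 an).
Qed.

Let measurable_height_alive n : measurable_fun setT (height_alive n).
Proof.
apply: measurable_fun_ifT => //; first exact: measurable_alive.
exact: (measurableT_comp measurable_snd (measurable_path n)).
Qed.

Let integrable_height_alive n : P.-integrable setT (EFin \o height_alive n).
Proof.
apply/integrableP; split; first exact/measurable_EFinP.
rewrite (eq_integral (fun w => (if alive n w then (walk_path n w).2 else 0)%:E)).
  by rewrite integral_height_alive ltey_eq killed_mean_fin.
move=> w _; rewrite /= /height_alive; case: ifP => an; last by rewrite normr0.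
by rewrite ger0_norm// (alive_ge0 z0 an).
Qed.

Let measurable_error n : measurable_fun setT (error n).
Proof.
apply: measurable_fun_ifT => //; first exact: measurable_alive.
apply: measurable_funB => //; apply: (measurableT_comp mh).
exact: (measurableT_comp measurable_fst (measurable_path n)).
Qed.

Let error_le n w : `|error n w| <= if alive n w then 2 * B else 0.
Proof.
rewrite /error; case: ifP; last by rewrite normr0.
move=> _; have := hB z.1; have := hB (walk_path n w).1.
by rewrite !ler_norml => /andP[? ?] /andP[? ?]; apply/andP; split; lra.
Qed.

Let integral_error n :
  (\int[P]_w `|error n w|%:E <= (2 * B)%:E * iter n killed (fun=> 1) z)%E.
Proof.
have B2 : 0 <= 2 * B by rewrite mulr_ge0// B_ge0.
rewrite -integral_alive// -ge0_integralZl_EFin//.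
- apply: ge0_le_integral => //.
  + apply/measurable_EFinP; exact: measurableT_comp.
  + apply: emeasurable_funM => //; apply: measurable_fun_ifT => //.
    exact: measurable_alive.
  + move=> w _; have := error_le n w; case: ifP => _; rewrite ?mule1 ?mule0 lee_fin//.
- by move=> w _; case: ifP.
- by apply: measurable_fun_ifT => //; exact: measurable_alive.
Qed.

Let integrable_error n : P.-integrable setT (EFin \o error n).
Proof.
have ic : P.-integrable setT (fun=> (2 * B)%:E).
  exact: finite_measure_integrable_cst.
apply: le_integrable ic => //; first exact/measurable_EFinP.
move=> w _; rewrite /= lee_fin (le_trans (error_le n w))//.
have B0 : 0 <= 2 * B by rewrite mulr_ge0// B_ge0.
by rewrite ger0_norm//; case: ifP.
Qed.

Let integrable_stopped_martingale n : P.-integrable setT (EFin \o stopped_martingale n).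
Proof. by have [] := integral_stopped_martingale n zS. Qed.

Let stopped_fun n : EFin \o stopped n =
  ((EFin \o stopped_martingale n) \- (EFin \o height_alive n) \+ (EFin \o error n))%E.
Proof. by apply/funext => w /=; rewrite stoppedE. Qed.

Let integrable_stopped n : P.-integrable setT (EFin \o stopped n).
Proof. by rewrite stopped_fun; apply: integrableD => //; exact: integrableB. Qed.

Let errm n := fine (\int[P]_w (error n w)%:E)%E.

Let integral_stopped n : (\int[P]_w (stopped n w)%:E =
  (z.2 - fine (killed_mean n z) + errm n)%:E)%E.
Proof.
transitivity (\int[P]_w ((EFin \o stopped n) w))%E => //.
rewrite stopped_fun integralD//; last exact: integrableB.
rewrite integralB//.
have [_ e1] := integral_stopped_martingale n zS.
have e2 : (\int[P]_w (EFin \o height_alive n) w = killed_mean n z)%E.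
  exact: integral_height_alive.
rewrite [X in (X - _ + _)%E]e1 e2 EFinD EFinB fineK// /errm fineK//.
exact: (integrable_fin_num measurableT (integrable_error n)).
Qed.

Let errm_cvg0 : errm n @[n --> \oo] --> (0 : R).
Proof.
apply/cvgrPdist_le => e e0.
(* Dividing by 2 B + 1 rather than by 2 B covers the case B = 0. *)
have B2 : 0 < 2 * B + 1 by rewrite ltr_wpDl// mulr_ge0// B_ge0.
have q0 : 0 < e / (2 * B + 1) by rewrite divr_gt0.
have := survival_cvg0 zS z0 q0; apply: filterS => n qn.
rewrite sub0r normrN -lee_fin -abse_EFin /errm fineK; last first.
  exact: (integrable_fin_num measurableT (integrable_error n)).
apply: le_trans (le_abse_integral P measurableT _) _.
  exact/measurable_EFinP.
apply: le_trans (integral_error n) _.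
apply: (@le_trans _ _ ((2 * B)%:E * (e / (2 * B + 1))%:E)%E).
  by apply: lee_wpmul2l => //; rewrite lee_fin mulr_ge0// B_ge0.
rewrite -EFinM lee_fin mulrCA ler_piMr//; first exact: ltW.
by rewrite ler_pdivrMr// mul1r lerDl.
Qed.

(** At the killing time the height is non-positive, so only two values of h remain. *)
Lemma dead_le w n : ~~ alive n w -> Mtau w <= 2 * B.
Proof.
elim: n => // n IH; case: (boolP (alive n w)) => [an|/IH //] dn.
rewrite (Mtau_stop an dn) /martingale.
have : (walk_path n.+1 w).2 <= 0 by move: dn => /=; rewrite an /= -leNgt.
have := hB z.1; have := hB (walk_path n.+1 w).1.
by rewrite !ler_norml => /andP[? ?] /andP[? ?]; lra.
Qed.

Let stopped_cvg w : stopped n w @[n --> \oo] --> Mtau w.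
Proof.
apply: cvg_near_cst.
have [[n dn]|nd] := pselect (exists n, ~~ alive n w).
  exists n => // m /= nm; rewrite /stopped; case: ifPn => // am.
  by rewrite (alive_le nm am) in dn.
have al n : alive n w by apply: contrapT => /negP an; apply: nd; exists n.
by exists 0%N => // m _; rewrite /stopped al Mtau_alive.
Qed.

Lemma measurable_Mtau : measurable_fun setT Mtau.
Proof.
apply: (measurable_fun_cvg (h := stopped)) => [n|w _]; last exact: stopped_cvg.
by have /measurable_int /measurable_EFinP := integrable_stopped n.
Qed.

Lemma Mtau_le w : Mtau w <= 2 * B.
Proof.
have [[n dn]|nd] := pselect (exists n, ~~ alive n w); first exact: dead_le dn.
rewrite Mtau_alive ?mulr_ge0 ?B_ge0// => n.
by apply: contrapT => /negP an; apply: nd; exists n.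
Qed.

(* Fatou's lemma applied to the nonnegative functions 2 B - stopped n. *)
Lemma integrable_Mtau : P.-integrable setT (EFin \o Mtau).
Proof.
have [C C0 hC] := iter_killed_height0_bound.
pose U n w := (2 * B - stopped n w)%:E.
have B0 := B_ge0.
have U0 n w : (0 <= U n w)%E.
  rewrite lee_fin /stopped; case: ifP => _; rewrite subr_ge0 ?mulr_ge0//.
  exact: Mtau_le.
have mstop n : measurable_fun setT (stopped n).
  by have /measurable_int /measurable_EFinP := integrable_stopped n.
have mU n : measurable_fun setT (U n).
  by apply/measurable_EFinP; exact: measurable_funB.
have Ulim w : limn_einf (U^~ w) = (2 * B - Mtau w)%:E.
  suff /cvg_limn_einf_sup[] : U n w @[n --> \oo] --> (2 * B - Mtau w)%:E by [].
  apply: cvg_EFin; first exact: nearW.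
  by apply: cvgB; [exact: cvg_cst|exact: stopped_cvg].
have iU n : (\int[P]_w U n w = (2 * B - (z.2 - fine (killed_mean n z) + errm n))%:E)%E.
  transitivity (\int[P]_w ((cst (2 * B)%:E \- (EFin \o stopped n))%E w))%E => //.
  rewrite integralB//; last exact: finite_measure_integrable_cst.
  rewrite [X in (X - _)%E]integral_cst//= probability_setT mule1.
  by rewrite [X in (_ - X)%E]integral_stopped.
have Ufin : (\int[P]_w (2 * B - Mtau w)%:E < +oo)%E.
  under eq_integral do rewrite -Ulim.
  apply: le_lt_trans (fatou P measurableT mU (fun n w _ => U0 n w)) _.
  apply: (@le_lt_trans _ _ (2 * B + C + 1)%:E); last exact: ltry.
  rewrite limn_einf_lim; apply: lime_le; first exact: is_cvg_einfs.
  have /cvgrPdist_le /(_ 1 ltr01) := errm_cvg0.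
  apply: filterS => n; rewrite sub0r normrN ler_norml => /andP[e1 _].
  apply: (@le_trans _ _ (\int[P]_w U n w)%E).
    by apply: ereal_inf_lbound; exists n => /=.
  rewrite iU lee_fin.
  have : fine (killed_mean n z) <= z.2 + C by rewrite -lee_fin fineK// hC.
  lra.
have mMtau := measurable_Mtau.
have i2 : P.-integrable setT (fun w => (2 * B - Mtau w)%:E).
  apply/integrableP; split; first by apply/measurable_EFinP; exact: measurable_funB.
  under eq_integral do rewrite gee0_abs ?lee_fin ?subr_ge0 ?Mtau_le//.
  exact: Ufin.
have i1 : P.-integrable setT (fun=> (2 * B)%:E).
  exact: finite_measure_integrable_cst.
have := integrableB measurableT i1 i2.
by apply: eq_integrable => // w _; rewrite /= -EFinB; congr EFin; ring.
Qed.

(** |Mtau| is integrable and dominates the stopped values, so their means converge;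
    [integral_stopped] expresses the killed mean through them and the vanishing [errm]. *)
Lemma killed_mean_cvg :
  killed_mean n z @[n --> \oo] --> (z.2%:E - \int[P]_w (Mtau w)%:E)%E.
Proof.
have iM := integrable_Mtau.
have Mfin : (\int[P]_w (Mtau w)%:E)%E \is a fin_num by exact: integrable_fin_num.
have : (\int[P]_w (stopped n w)%:E)%E @[n --> \oo] --> (\int[P]_w (Mtau w)%:E)%E.
  apply: (@dominated_cvg _ _ _ P setT measurableT (fun n w => (stopped n w)%:E)
    (EFin \o Mtau) (fun w => `|Mtau w|%:E)) => //.
  - by move=> n; have /measurable_int := integrable_stopped n.
  - by move=> w _; apply: cvg_EFin; [exact: nearW|exact: stopped_cvg].
  - exact: integrable_norm.
  - move=> n w _; rewrite /= lee_fin /stopped; case: ifP => // _.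
    by rewrite normr0.
rewrite -(fineK Mfin) => /fine_cvg cs.
apply: cvg_EFin; first exact: nearW.
rewrite (_ : fine \o _ = fun n => z.2 + errm n -
    fine (\int[P]_w (stopped n w)%:E)%E).
  rewrite -[X in _ --> X]/(z.2 - _); apply: cvgB => //.
  by rewrite -[X in _ --> X]addr0; apply: cvgD => //; exact: cvg_cst.
by apply/funext => n /=; rewrite integral_stopped /=; ring.
Qed.

Lemma renewalE : renewal z = (z.2%:E - \int[P]_w (Mtau w)%:E)%E.
Proof. by have [_] := cvg_limn_einf_sup killed_mean_cvg. Qed.

Lemma renewal_cvg : killed_mean n z @[n --> \oo] --> renewal z.
Proof. by rewrite renewalE; exact: killed_mean_cvg. Qed.

Lemma renewal_ge : ((z.2 - 2 * B)%:E <= renewal z)%E.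
Proof.
have B2 : 0 <= 2 * B by rewrite mulr_ge0// B_ge0.
rewrite renewalE EFinB leeB//.
have -> : ((2 * B)%:E = \int[P]_w cst (2 * B)%:E w)%E.
  by rewrite integral_cst//= probability_setT mule1.
apply: le_integral => //; first exact: integrable_Mtau.
  exact: finite_measure_integrable_cst.
by move=> w _; rewrite lee_fin; exact: Mtau_le.
Qed.

End stopping.

End walk_path.

(** * Properties of the renewal function *)

Section renewal_properties.
Context {dO : measure_display} {Omega : measurableType dO}.
Context (P : probability Omega R) (xi : nat -> Omega -> G).
Hypotheses (hxi : iid_seq mu P xi) (xiS : forall n w, SG (xi n w)).

(** A concrete [Mtau], which makes the previous section available at every starting point; the least
    n at which the path is not alive is the killing time. *)
Let stopped_value z w : R :=
  if pselect (exists n, ~~ alive xi z n w) is left ex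
  then martingale xi z (ex_minn ex) w else 0.

Let stopped_value_stop z n w : alive xi z n w -> ~~ alive xi z n.+1 w ->
  stopped_value z w = martingale xi z n.+1 w.
Proof.
move=> an dn; rewrite /stopped_value; case: pselect => [ex|]; last first.
  by case; exists n.+1.
case: ex_minnP => m dm mmin; suff -> : m = n.+1 by [].
apply/eqP; rewrite eqn_leq mmin//= ltnNge; apply/negP => mn.
by rewrite (alive_le mn an) in dm.
Qed.

Let stopped_value_alive z w : (forall n, alive xi z n w) -> stopped_value z w = 0.
Proof.
move=> al; rewrite /stopped_value; case: pselect => // ex.
by exfalso; case: ex => n; rewrite al.
Qed.

Lemma killed_mean_cvg_renewal (z : E * R) : SE z.1 -> 0 <= z.2 ->
  killed_mean n z @[n --> \oo] --> renewal z.
Proof.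
exact: (renewal_cvg hxi xiS (@stopped_value_stop z) (@stopped_value_alive z)).
Qed.

Lemma renewal_lower (z : E * R) : SE z.1 -> 0 <= z.2 ->
  ((z.2 - 2 * B)%:E <= renewal z)%E.
Proof.
exact: (renewal_ge hxi xiS (@stopped_value_stop z) (@stopped_value_alive z)).
Qed.

Lemma renewal_ge0 (z : E * R) : SE z.1 -> 0 <= z.2 -> (0 <= renewal z)%E.
Proof.
move=> zS z0; have c := killed_mean_cvg_renewal zS z0.
rewrite -(cvg_lim _ c)//; apply: lime_ge; first by apply/cvg_ex; exists (renewal z).
by apply: nearW => n; exact: killed_mean_ge0.
Qed.

Lemma renewal_upper : exists2 C : R, 0 <= C & forall z : E * R,
  SE z.1 -> 0 <= z.2 -> (renewal z <= (z.2 + C)%:E)%E.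
Proof.
have [C C0 hC] := iter_killed_height0_bound; exists C => // z zS z0.
have c := killed_mean_cvg_renewal zS z0.
rewrite -(cvg_lim _ c)//; apply: lime_le; first by apply/cvg_ex; exists (renewal z).
by apply: nearW => n; exact: hC.
Qed.

Lemma renewal_nondecreasing x (a b : R) : SE x -> 0 <= a -> a <= b ->
  (renewal (x, a) <= renewal (x, b))%E.
Proof.
move=> xS a0 ab; have b0 := le_trans a0 ab.
apply: lee_cvg_to (@killed_mean_cvg_renewal (x, a) xS a0)
  (@killed_mean_cvg_renewal (x, b) xS b0) _.
by apply: nearW => n; exact: killed_mean_nondecreasing.
Qed.

(** Limit of the recursion killed_mean n.+1 = killed (killed_mean n); the uniform bound on mean
    heights lets [ell] plus a constant dominate. *)
Lemma renewal_harmonic (z : E * R) : SE z.1 -> 0 <= z.2 ->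
  renewal z = killed renewal z.
Proof.
move=> zS z0.
have [C C0 hC] := iter_killed_height0_bound.
have c1 : killed_mean n.+1 z @[n --> \oo] --> renewal z.
  by have := killed_mean_cvg_renewal zS z0; rewrite -cvg_shiftS.
have c2 : killed (killed_mean n) z @[n --> \oo] --> killed renewal z.
  apply: (@dominated_cvg _ _ _ mu SG mSG
    (fun n g => if (0 < (step g z).2)%R then killed_mean n (step g z) else 0%E)
    (fun g => if (0 < (step g z).2)%R then renewal (step g z) else 0%E)
    (fun g => (ell g + (z.2 + C))%:E)).
  - by move=> n; apply: measurable_killed_integrand1; exact: measurable_killed_mean.
  - move=> g gS; case: ifP => [s0|_]; last exact: cvg_cst.
    by apply: killed_mean_cvg_renewal; [exact: act_stable|exact: ltW].
  - by [].
  - exact: integrable_ellD.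
  - move=> n g gS; have lz : 0 <= ell g + (z.2 + C).
      by rewrite !addr_ge0// ell_ge0.
    case: ifP => [s0|_]; last by rewrite abse0 lee_fin.
    rewrite gee0_abs ?killed_mean_ge0//.
    apply: le_trans (hC n _ _ (ltW s0)) _; first exact: act_stable.
    rewrite lee_fin /step/=; have := rho_ell gS zS; rewrite ler_norml => /andP[_].
    lra.
by rewrite -(cvg_lim _ c1)// -(cvg_lim _ c2).
Qed.

(** Harmonicity is restricted to the matrices of [Gd]: such a step has probability [p], survives
    because rho >= delta > 0, and lifts the height by at least delta. *)
Lemma renewal_lower_iter k (z : E * R) : SE z.1 -> 0 <= z.2 ->
  ((p ^+ k * (z.2 + k%:R * delta - 2 * B))%:E <= renewal z)%E.
Proof.
elim: k z => [|k IH] z zS z0.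
  by rewrite expr0 mul0r mul1r addr0; exact: renewal_lower.
rewrite renewal_harmonic//.
pose c := p ^+ k * (z.2 + k.+1%:R * delta - 2 * B).
have -> : p ^+ k.+1 * (z.2 + k.+1%:R * delta - 2 * B) = c * p.
  by rewrite exprS /c; ring.
have mr := measurable_killed_integrand1 z measurable_renewal.
have f0 g : SG g -> (0 <= if (0 < (step g z).2)%R then renewal (step g z) else 0)%E.
  move=> gS; case: ifP => // s0; apply: renewal_ge0; last exact: ltW.
  exact: act_stable.
rewrite /killed.
apply: (@le_trans _ _ (\int[mu]_(g in Gd)
    if (0 < (step g z).2)%R then renewal (step g z) else 0)%E); last first.
  exact: ge0_subset_integral.
(* Comparison of non-negative integrands requires a positive c; for c <= 0 the bound follows from
   the non-negativity of the integral. *)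
have [cneg|cpos] := leP c 0.
  apply: (@le_trans _ _ 0%E).
    by rewrite lee_fin mulr_le0_ge0// ltW// p_gt0.
  by apply: integral_ge0 => g /GdSG; exact: f0.
have -> : ((c * p)%:E = \int[mu]_(g in Gd) cst c%:E g)%E.
  by rewrite integral_cst//= EFinM /p fineK// fin_num_measure.
apply: ge0_le_integral => //.
- by move=> g _; rewrite lee_fin ltW.
- exact: measurable_funS mr.
move=> g gGd; have gS := GdSG gGd; have rd := rho_delta gGd zS.
have s0 : 0 < (step g z).2.
  by rewrite /step/= ltr_wpDl// (lt_le_trans delta_gt0).
rewrite s0; apply: le_trans (IH (step g z) _ (ltW s0)); last exact: act_stable.
rewrite lee_fin /c ler_wpM2l ?exprn_ge0 ?(ltW p_gt0)// /step/= -natr1 mulrDl mul1r; lra.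
Qed.

Lemma renewal_gt0 : exists2 c : R, 0 < c & forall z : E * R,
  SE z.1 -> 0 <= z.2 -> (c%:E <= renewal z)%E.
Proof.
(* Enough steps for k delta to exceed 2 B + 1, so that the bracket in [renewal_lower_iter] is at
   least 1 at every starting height. *)
pose k := (Num.truncn ((2 * B + 1) / delta)).+1.
exists (p ^+ k); first by rewrite exprn_gt0// p_gt0.
move=> z zS z0; apply: le_trans (renewal_lower_iter k zS z0).
rewrite lee_fin ler_peMr ?exprn_ge0 ?(ltW p_gt0)//.
have : (2 * B + 1) / delta < k%:R by exact: truncnS_gt.
rewrite ltr_pdivrMr//; lra.
Qed.

Lemma renewal_nonneg (z : E * R) : (0 <= renewal z)%E.
Proof.
rewrite /renewal limn_esup_lim; apply: lime_ge; first exact: is_cvg_esups.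
apply: nearW => n; apply: le_trans (killed_mean_ge0 n z) _.
by apply: ereal_sup_ubound; exists n => /=.
Qed.

Lemma renewal_theorem :
  [/\ forall z : E * R, SE z.1 -> 0 <= z.2 -> forall Mtau : Omega -> R,
        (forall n w, alive xi z n w -> ~~ alive xi z n.+1 w ->
           Mtau w = martingale xi z n.+1 w) ->
        (forall w, (forall n, alive xi z n w) -> Mtau w = 0) ->
        renewal z = (z.2%:E - \int[P]_w (Mtau w)%:E)%E,
      forall z : E * R, SE z.1 -> 0 <= z.2 ->
        (\int[P]_w (if alive xi z n w then (walk_path xi z n w).2 else 0)%:E)%E
          @[n --> \oo] --> renewal z,
      forall x (a b : R), SE x -> 0 <= a -> a <= b ->
        (renewal (x, a) <= renewal (x, b))%E,
      exists c C : R, [/\ 0 < c, 0 < C & forall z : E * R, SE z.1 -> 0 <= z.2 ->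
        [/\ (c%:E <= renewal z)%E, ((z.2 - C)%:E <= renewal z)%E &
            (renewal z <= (z.2 + C)%:E)%E]] &
      forall z : E * R, SE z.1 -> 0 <= z.2 -> renewal z =
        (\int[P]_w if alive xi z 1 w then renewal (walk_path xi z 1 w) else 0)%E].
Proof.
split.
- move=> z zS z0 Mtau M1 M2; exact: (renewalE hxi xiS M1 M2).
- move=> z zS z0; under eq_cvg do rewrite (integral_height_alive hxi xiS z0).
  exact: killed_mean_cvg_renewal.
- exact: renewal_nondecreasing.
- have [C C0 hC] := renewal_upper; have [c c0 hc] := renewal_gt0.
  have B0 := B_ge0.
  exists c, (C + 2 * B + 1); split => //; first by lra.
  move=> z zS z0; split; first exact: hc.
    by apply: le_trans (renewal_lower zS z0); rewrite lee_fin; lra.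
  by apply: le_trans (hC z zS z0) _; rewrite lee_fin; lra.
- move=> z zS z0; rewrite (integral_alive hxi xiS z 1 measurable_renewal renewal_nonneg).
  exact: renewal_harmonic.
Qed.

End renewal_properties.

End killed_walk.

(** * Borel measurability of matrix-valued maps *)

Section borel_matrices.
Context {R : realType} {m n : nat}.
Local Notation borel := (g_sigma_algebraType (@open 'M[R]_(m, n))).

Lemma measurable_coord i j : measurable_fun setT (fun A : borel => A i j).
Proof.
apply: (measurability _ (RGenOpens.measurableE R)) => _ [_ [a [b ->]] <-].
rewrite setTI; apply: sub_sigma_algebra.
have /continuousP := @coord_continuous R m n i j.
by apply; exact: interval_open.
Qed.

(** Every open set is a countable union of boxes with rational centres and radii 1 / (k + 1), and
    lying in a box is a condition on finitely many coordinates. *)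
Lemma measurable_mx d (T : measurableType d) (F : T -> borel) :
  (forall i j, measurable_fun setT (fun t => F t i j)) -> measurable_fun setT F.
Proof.
move=> mF; apply: (measurability (rT := borel) (@open 'M[R]_(m, n))) => // _ [U oU <-].
rewrite setTI.
pose box (qk : 'M[rat]_(m, n) * nat) : set 'M[R]_(m, n) :=
  [set A | forall i j, `|A i j - ratr (qk.1 i j)| < qk.2.+1%:R^-1].
rewrite (_ : F @^-1` U = \bigcup_qk [set t | box qk `<=` U /\ box qk (F t)]).
  apply: countable_bigcupT_measurable; first exact: countableP.
  move=> qk; have [bU|nbU] := pselect (box qk `<=` U); last first.
    by rewrite (_ : mkset _ = set0)//; apply/seteqP; split => t //= -[].
  rewrite (_ : mkset _ = \bigcap_(i in [set: 'I_m]) \bigcap_(j in [set: 'I_n])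
      [set t | `|F t i j - ratr (qk.1 i j)| < qk.2.+1%:R^-1]); last first.
    apply/seteqP; split => t /=; first by move=> [_ bt] i _ j _; exact: bt.
    by move=> bt; split => // i j; exact: bt.
  apply: fin_bigcap_measurable => // i _; apply: fin_bigcap_measurable => // j _.
  rewrite -[X in measurable X]setTI.
  have : measurable_fun setT
      (fun t => `|F t i j - ratr (qk.1 i j)| < qk.2.+1%:R^-1 :> R).
    apply: measurable_fun_ltr => //; apply: measurableT_comp => //.
    exact: measurable_funB.
  by move=> /(_ measurableT [set true]); apply.
apply/seteqP; split => [t /= Ut|t [qk _ [bU bt]]]; last exact: bU.
have /nbhs_ballP[e /= e0 eU] : nbhs (F t) U by exact: open_nbhs_nbhs.
(* A box of this radius containing [F t] has all its points within 2 / (k + 1) < e of it. *)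
have [k ke] : exists k : nat, 2 * k.+1%:R^-1 < e :> R.
  exists (Num.truncn (2 / e)); rewrite ltr_pdivrMr// mulrC -ltr_pdivrMr//.
  exact: truncnS_gt.
have rx (x : R) : exists q : rat, `|x - ratr q| < k.+1%:R^-1.
  have k0 : 0 < k.+1%:R^-1 :> R by rewrite invr_gt0.
  have /rat_in_itvoo[q] : x - k.+1%:R^-1 < x + k.+1%:R^-1.
    by rewrite ltrD2l (lt_trans _ k0)// oppr_lt0.
  by rewrite in_itv/= => ?; exists q; rewrite ltr_distlC.
pose q := \matrix_(i, j) projT1 (cid (rx (F t i j))).
have qE i j : `|F t i j - ratr (q i j)| < k.+1%:R^-1.
  by rewrite mxE; case: cid.
exists (q, k) => //; split; last exact: qE.
move=> A bA; apply: eU; split => // i j; rewrite -ball_normE /ball_/=.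
rewrite (le_lt_trans _ ke)// mulr_natl mulr2n.
have -> : F t i j - A i j = (F t i j - ratr (q i j)) - (A i j - ratr (q i j)) by ring.
by rewrite (le_trans (ler_normB _ _))// lerD// ltW.
Qed.

End borel_matrices.

(** * Positive matrices and projective contraction *)

Section positive_matrices.
Context {R : realType} {d : nat}.
Implicit Types (g a : 'M[R]_d.+1) (x y u : 'cV[R]_d.+1).

Definition mass x : R := \sum_i x i ord0.

Lemma norm1_cone x : cone x -> norm1 x = mass x.
Proof. by move=> x0; apply: eq_bigr => i _; rewrite ger0_norm. Qed.

Lemma simplexP x : simplex x <-> (forall i, 0 <= x i ord0) /\ mass x = 1.
Proof.
split=> [[x0 x1]|[x0 x1]]; first by rewrite -norm1_cone.
by split => //; rewrite norm1_cone.
Qed.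

Lemma mass_mulmx g x : mass (g *m x) = \sum_j colsum g j * x j ord0.
Proof.
rewrite /mass; under eq_bigr do rewrite mxE.
by rewrite exchange_big; apply: eq_bigr => j _; rewrite mulr_suml.
Qed.

Lemma cone_mulmx g x : semiS g -> cone x -> cone (g *m x).
Proof.
by move=> [g0 _] x0 i; rewrite mxE; apply: sumr_ge0 => j _; rewrite mulr_ge0.
Qed.

Lemma colsum_gt0 g j : semiS g -> 0 < colsum g j.
Proof.
move=> [g0 gp]; have [i gi] := gp j.
by rewrite /colsum (bigD1 i)//= ltr_wpDr// sumr_ge0.
Qed.

Lemma mx_v_le g j : mx_v g <= colsum g j.
Proof. by rewrite /mx_v; exact: bigmin_le_cond. Qed.

Lemma mx_norm1_ge g j : colsum g j <= mx_norm1 g.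
Proof. by rewrite /mx_norm1; exact: le_bigmax_cond. Qed.

Lemma mx_v_gt0 g : semiS g -> 0 < mx_v g.
Proof.
move=> gS; rewrite /mx_v; apply: (big_ind (fun u : R => 0 < u)) => [|u v u0 v0|i _].
- exact: colsum_gt0.
- by rewrite lt_min u0 v0.
- exact: colsum_gt0.
Qed.

Lemma mx_N_ge1 g : semiS g -> 1 <= mx_N g.
Proof.
move=> gS; rewrite /mx_N le_max.
have v0 := mx_v_gt0 gS; have [v1|v1] := leP (mx_v g) 1.
  by rewrite invf_ge1// v1.
apply/orP; right; apply: le_trans (ltW v1) _.
exact: le_trans (mx_v_le g ord0) (mx_norm1_ge g ord0).
Qed.

Lemma norm1_mulmx_bounds g x : semiS g -> simplex x ->
  (mx_N g)^-1 <= norm1 (g *m x) <= mx_N g.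
Proof.
move=> gS /simplexP[x0 x1]; rewrite norm1_cone; last exact: cone_mulmx.
rewrite mass_mulmx; have v0 := mx_v_gt0 gS.
have N0 : 0 < mx_N g by rewrite (lt_le_trans ltr01)// mx_N_ge1.
apply/andP; split.
  apply: (@le_trans _ _ (mx_v g)).
    by rewrite -[leRHS]invrK lef_pV2 ?posrE ?invr_gt0// /mx_N le_max lexx.
  rewrite -[leLHS]mulr1 -x1 mulr_sumr; apply: ler_sum => j _.
  by rewrite ler_wpM2r// mx_v_le.
apply: (@le_trans _ _ (mx_norm1 g)); last by rewrite /mx_N le_max lexx orbT.
rewrite -[leRHS]mulr1 -x1 mulr_sumr; apply: ler_sum => j _.
by rewrite ler_wpM2r// mx_norm1_ge.
Qed.

Lemma norm1_mulmx_gt0 g x : semiS g -> simplex x -> 0 < norm1 (g *m x).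
Proof.
move=> gS xS; have /andP[+ _] := norm1_mulmx_bounds gS xS.
apply: lt_le_trans; rewrite invr_gt0 (lt_le_trans ltr01)// mx_N_ge1//.
Qed.

Lemma rho_le_lnN g x : semiS g -> simplex x -> `|rho g x| <= ln (mx_N g).
Proof.
move=> gS xS; have /andP[b1 b2] := norm1_mulmx_bounds gS xS.
have N0 : 0 < mx_N g by rewrite (lt_le_trans ltr01)// mx_N_ge1.
have n0 := norm1_mulmx_gt0 gS xS.
by rewrite ler_norml /rho -lnV ?posrE// !ler_ln ?posrE ?invr_gt0// b1 b2.
Qed.

Lemma massZ c x : mass (c *: x) = c * mass x.
Proof. by rewrite /mass mulr_sumr; apply: eq_bigr => i _; rewrite mxE. Qed.

Lemma proj_act_simplex g x : semiS g -> simplex x -> simplex (proj_act g x).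
Proof.
move=> gS xS; have n0 := norm1_mulmx_gt0 gS xS.
have c : cone (g *m x) by apply: cone_mulmx => //; case: xS.
apply/simplexP; split => [i|].
  by rewrite mxE mulr_ge0// invr_ge0 ltW.
by rewrite massZ -norm1_cone// mulVf// gt_eqF.
Qed.

Lemma norm1Z c x : 0 <= c -> norm1 (c *: x) = c * norm1 x.
Proof.
move=> c0; rewrite /norm1 mulr_sumr; apply: eq_bigr => i _.
by rewrite mxE normrM ger0_norm.
Qed.

Lemma proj_act1 x : simplex x -> proj_act 1%:M x = x.
Proof. by move=> [_ x1]; rewrite /proj_act mul1mx x1 invr1 scale1r. Qed.

Lemma semiS1 : semiS (1%:M : 'M[R]_d.+1).
Proof.
split=> [i j|j]; first by rewrite mxE ler0n.
by exists j; rewrite mxE eqxx.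
Qed.

Lemma semiS_mulmx g a : semiS g -> semiS a -> semiS (g *m a).
Proof.
move=> [g0 gp] [a0 ap]; split=> [i j|j].
  by rewrite mxE sumr_ge0// => k _; rewrite mulr_ge0.
have [k ak] := ap j; have [i gi] := gp k; exists i.
by rewrite mxE (bigD1 k)//= ltr_wpDr ?mulr_gt0// sumr_ge0// => l _; rewrite mulr_ge0.
Qed.

Lemma proj_actM g a x : semiS g -> semiS a -> simplex x ->
  proj_act (g *m a) x = proj_act g (proj_act a x).
Proof.
move=> gS aS xS; have n0 := norm1_mulmx_gt0 aS xS.
rewrite /proj_act -scalemxAr norm1Z ?invr_ge0 ?(ltW n0)// mulmxA scalerA.
congr (_ *: _); rewrite invfM invrK mulrAC mulfV ?mul1r//.
by rewrite gt_eqF.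
Qed.

(* 1 - l * b is a projective quantity: it does not change when x and y are
   rescaled. It plays the role of Hennion's projective distance. *)
Definition proj_close (e : R) x y :=
  exists l b : R, [/\ 0 <= l, 0 <= b, (forall i, l * y i ord0 <= x i ord0),
    (forall i, b * x i ord0 <= y i ord0) & 1 - e <= l * b].

Lemma proj_close_le1 x y l : simplex x -> simplex y ->
  (forall i, l * y i ord0 <= x i ord0) -> l <= 1.
Proof.
move=> /simplexP[_ x1] /simplexP[_ y1] lyx.
by rewrite -x1 -[l]mulr1 -y1 mulr_sumr; apply: ler_sum.
Qed.

Lemma proj_close_ge0 e x y : simplex x -> simplex y -> proj_close e x y -> 0 <= e.
Proof.
move=> xS yS [l [b [l0 b0 lyx bxy]]].
have := proj_close_le1 xS yS lyx; have := proj_close_le1 yS xS bxy.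
have := mulr_ge0 l0 b0; nra.
Qed.

Lemma proj_close1 x y : simplex x -> simplex y -> proj_close 1 x y.
Proof.
move=> /simplexP[x0 _] /simplexP[y0 _]; exists 0, 0.
by split => // *; rewrite ?mul0r// subrr.
Qed.

(** For non-negative g, the images of any two points of the simplex are then comparable
    coordinatewise with ratio [e]; a zero row is allowed. *)
Definition row_comparable (e : R) g := forall i j k, e * g i k <= g i j.

(** The vector x - l y is non-negative of mass 1 - l, and row comparability makes its image at least
    e (1 - l) times that of y. *)
Lemma row_comparable_mulmx e g x y l : semiS g -> row_comparable e g ->
  simplex x -> simplex y -> (forall i, l * y i ord0 <= x i ord0) ->
  forall i, (l + e * (1 - l)) * (g *m y) i ord0 <= (g *m x) i ord0.
Proof.
move=> [g0 _] ge /simplexP[x0 x1] /simplexP[y0 y1] lyx i; rewrite !mxE.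
set S := \sum_j g i j * y j ord0; set T := \sum_j g i j * x j ord0.
have : (e * S) * (1 - l) <= \sum_j g i j * (x j ord0 - l * y j ord0).
  rewrite -[X in X - l]x1 -[l in leLHS]mulr1 -y1 [l * _]mulr_sumr -sumrB mulr_sumr.
  apply: ler_sum => j _; rewrite ler_wpM2r ?subr_ge0//.
  rewrite -[leRHS]mulr1 -y1 !mulr_sumr; apply: ler_sum => k _.
  by rewrite mulrA ler_wpM2r.
have -> : \sum_j g i j * (x j ord0 - l * y j ord0) = T - l * S.
  rewrite /T /S mulr_sumr -sumrB; apply: eq_bigr => j _; ring.
lra.
Qed.

Lemma proj_close_scale e x y s t : 0 < s -> 0 < t ->
  proj_close e x y -> proj_close e (s *: x) (t *: y).
Proof.
move=> s0 t0 [l [b [l0 b0 lyx bxy lb]]].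
exists (l * s / t), (b * t / s); split.
- by rewrite divr_ge0 ?mulr_ge0// ltW.
- by rewrite divr_ge0 ?mulr_ge0// ltW.
- move=> i; rewrite !mxE mulrA divfK ?gt_eqF// [l * s]mulrC -mulrA.
  by rewrite ler_pM2l.
- move=> i; rewrite !mxE mulrA divfK ?gt_eqF// [b * t]mulrC -mulrA.
  by rewrite ler_pM2l.
- by apply: le_trans lb _; rewrite le_eqVlt; apply/orP; left; apply/eqP; field;
    rewrite !gt_eqF.
Qed.

(** Each one-sided constant moves towards 1 by the fraction c of its distance to 1. With u = 1 - l
    and v = 1 - b in [0, 1], the contraction reduces to 2 u v <= u + v. *)
Lemma proj_close_act c e g x y : semiS g -> row_comparable c g ->
  0 <= c <= 1 -> simplex x -> simplex y -> proj_close e x y ->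
  proj_close ((1 - c ^+ 2) * e) (proj_act g x) (proj_act g y).
Proof.
move=> gS gc /andP[c0 c1] xS yS [l [b [l0 b0 lyx bxy lb]]].
have l1 := proj_close_le1 xS yS lyx; have b1 := proj_close_le1 yS xS bxy.
apply: proj_close_scale; rewrite ?invr_gt0 ?norm1_mulmx_gt0//.
exists (l + c * (1 - l)), (b + c * (1 - b)); split.
- by rewrite addr_ge0// mulr_ge0// subr_ge0.
- by rewrite addr_ge0// mulr_ge0// subr_ge0.
- exact: row_comparable_mulmx.
- exact: row_comparable_mulmx.
have : 0 <= (1 - c ^+ 2) * (e - (1 - l * b)).
  by rewrite mulr_ge0// ?subr_ge0 ?expr_le1//; lra.
have : 0 <= c * (1 - c) * ((1 - l) - (1 - l) * (1 - b)).
  by rewrite mulr_ge0 ?mulr_ge0 ?subr_ge0// -[leRHS]mulr1 ler_wpM2l ?subr_ge0//; lra.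
have : 0 <= c * (1 - c) * ((1 - b) - (1 - l) * (1 - b)).
  rewrite mulr_ge0 ?mulr_ge0 ?subr_ge0// -[leRHS]mul1r ler_wpM2r ?subr_ge0//; lra.
lra.
Qed.

Lemma row_comparable0 g : semiS g -> row_comparable 0 g.
Proof. by move=> [g0 _] i j k; rewrite mul0r. Qed.

Lemma proj_close_act0 e g x y : semiS g -> simplex x -> simplex y ->
  proj_close e x y -> proj_close e (proj_act g x) (proj_act g y).
Proof.
move=> gS xS yS cl; have := proj_close_act gS (row_comparable0 gS) _ xS yS cl.
by rewrite expr0n/= subr0 mul1r; apply; rewrite lexx ler01.
Qed.

Lemma posS_row_comparable g : posS g -> exists k : nat, row_comparable k.+1%:R^-1 g.
Proof.
move=> g0.
(* Each ratio is at most the sum of all ratios, so one integer serves all indices. *)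
pose t := \sum_i \sum_j \sum_k g i k / g i j.
exists (Num.truncn t) => i j k.
rewrite mulrC ler_pdivrMr// mulrC -ler_pdivrMr//.
apply: le_trans (ltW (truncnS_gt t)); rewrite /t.
rewrite (bigD1 i)//= (bigD1 j)//= (bigD1 k)//= -!addrA lerDl !addr_ge0//.
- by apply: sumr_ge0 => l _; rewrite divr_ge0// ltW.
- by apply: sumr_ge0 => l _; apply: sumr_ge0 => l' _; rewrite divr_ge0// ltW.
- apply: sumr_ge0 => l _; apply: sumr_ge0 => l' _; apply: sumr_ge0 => l'' _.
  by rewrite divr_ge0// ltW.
Qed.

(** For e >= 1/2 the crude bound 2 ln N suffices. For e < 1/2 both one-sided constants are at least
    1 - e, hence so are the ratios of the two norms, and -ln(1 - e) <= 2 e. *)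
Lemma rho_close e g x y : semiS g -> simplex x -> simplex y ->
  proj_close e x y -> `|rho g x - rho g y| <= (2 + 4 * ln (mx_N g)) * e.
Proof.
move=> gS xS yS cl; have e0 := proj_close_ge0 xS yS cl.
have := rho_le_lnN gS xS; have := rho_le_lnN gS yS.
rewrite !ler_norml => /andP[ry1 ry2] /andP[rx1 rx2].
have N0 : 0 <= ln (mx_N g) by rewrite ln_ge0// mx_N_ge1.
have [e2|e2] := leP (1 / 2) e.
  have : 0 <= ln (mx_N g) * (e - 1 / 2) by rewrite mulr_ge0 ?subr_ge0.
  by move=> ?; apply/andP; split; lra.
case: cl => l [b [l0 b0 lyx bxy lb]].
have l1 := proj_close_le1 xS yS lyx; have b1 := proj_close_le1 yS xS bxy.
have key z t s : simplex z -> simplex t -> 1 - e <= s -> (forall i, s * t i ord0 <= z i ord0) ->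
    rho g t - rho g z <= 2 * e.
  move=> zS tS es stz; have s0 : 0 < s by lra.
  have nz := norm1_mulmx_gt0 gS zS; have nt := norm1_mulmx_gt0 gS tS.
  have st : s * norm1 (g *m t) <= norm1 (g *m z).
    rewrite !norm1_cone ?mass_mulmx; try (by apply: cone_mulmx => //; case: zS; case: tS).
    rewrite mulr_sumr; apply: ler_sum => j _; rewrite mulrCA ler_wpM2l//.
    by rewrite ltW// colsum_gt0.
  have : ln (s * norm1 (g *m t)) <= ln (norm1 (g *m z)).
    by rewrite ler_ln ?posrE ?mulr_gt0.
  rewrite lnM ?posrE// /rho => h.
  have : - ln s <= 2 * e.
    rewrite -lnV ?posrE//; have -> : s^-1 = 1 + (s^-1 - 1) by ring.
    have si0 : 0 < s^-1 by rewrite invr_gt0.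
    apply: le_trans (le_ln1Dx _) _; first by lra.
    have : s * s^-1 = 1 by rewrite mulfV// gt_eqF.
    move: (s^-1) si0 => r r0 sr; have : 0 <= r * (s - (1 - e)) by rewrite mulr_ge0 ?subr_ge0// ltW.
    nra.
  lra.
have sl : 1 - e <= l by rewrite (le_trans lb)// ler_piMr.
have sb : 1 - e <= b by rewrite (le_trans lb)// ler_piMl.
have := key _ _ _ xS yS sl lyx; have := key _ _ _ yS xS sb bxy.
have : 0 <= ln (mx_N g) * e by rewrite mulr_ge0.
by move=> ? ? ?; apply/andP; split; lra.
Qed.

End positive_matrices.

(** * Measurability of the action, of rho and of the relevant sets *)

Section measurability.
Context {R : realType} {d : nat}.
Local Notation G := (borelM R d).
Local Notation E := (borelV R d).

Lemma measurable_mulmx_vec d' (T : measurableType d') (a : T -> G) (x : T -> E) :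
  measurable_fun setT a -> measurable_fun setT x ->
  measurable_fun setT (fun t => a t *m x t : E).
Proof.
move=> ma mx; apply: measurable_mx => i j.
under eq_fun do rewrite mxE.
apply: measurable_sum => k; apply: measurable_funM.
  exact: (measurableT_comp (measurable_coord i k) ma).
exact: (measurableT_comp (measurable_coord k j) mx).
Qed.

Lemma measurable_mulmx_mat d' (T : measurableType d') (a b : T -> G) :
  measurable_fun setT a -> measurable_fun setT b ->
  measurable_fun setT (fun t => a t *m b t : G).
Proof.
move=> ma mx; apply: measurable_mx => i j.
under eq_fun do rewrite mxE.
apply: measurable_sum => k; apply: measurable_funM.
  exact: (measurableT_comp (measurable_coord i k) ma).
exact: (measurableT_comp (measurable_coord k j) mx).
Qed.

Lemma measurable_norm1 : measurable_fun setT (norm1 : E -> R).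
Proof.
apply: measurable_sum => i; apply: measurableT_comp => //.
exact: measurable_coord.
Qed.

(** Inversion is discontinuous at 0, where its value is 0 by convention; elsewhere it is exp(-ln
    |x|) with the sign of x. *)
Lemma measurable_invr : measurable_fun setT (fun x : R => x^-1).
Proof.
rewrite (_ : (fun x => _) = (fun x => if x < 0 then - expR (- ln (- x)) else
    if x == 0 then 0 else expR (- ln x))).
  apply: measurable_fun_ifT; first exact: measurable_fun_ltr.
    do 2 (apply: measurableT_comp => //); apply: measurableT_comp => //.
    by apply: measurableT_comp.
  apply: measurable_fun_ifT => //; first exact: measurable_fun_eqr.
  by apply: measurableT_comp => //; apply: measurableT_comp.
apply/funext => x; have [x0|x0|->] := ltgtP x 0; last by rewrite invr0.
  by rewrite expRN lnK ?posrE ?oppr_gt0// invrN opprK.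
by rewrite expRN lnK ?posrE.
Qed.

Lemma measurable_proj_act : measurable_fun setT (fun z : G * E => proj_act z.1 z.2 : E).
Proof.
have mm : measurable_fun setT (fun z : G * E => z.1 *m z.2 : E).
  exact: measurable_mulmx_vec.
apply: measurable_mx => i j; under eq_fun do rewrite mxE.
apply: measurable_funM; last exact: (measurableT_comp (measurable_coord i j) mm).
apply: (measurableT_comp measurable_invr).
exact: (measurableT_comp measurable_norm1 mm).
Qed.

Lemma measurable_rho_pair : measurable_fun setT (fun z : G * E => rho z.1 z.2).
Proof.
apply: measurableT_comp => //; apply: (measurableT_comp measurable_norm1).
exact: measurable_mulmx_vec.
Qed.

Lemma measurable_colsum j : measurable_fun setT (fun g : G => colsum g j).
Proof. by apply: measurable_sum => i; exact: measurable_coord. Qed.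

Lemma measurable_mx_N : measurable_fun setT (mx_N : G -> R).
Proof.
apply: measurable_maxr.
  apply: (measurableT_comp measurable_invr); rewrite /mx_v.
  under eq_fun do rewrite -big_enum/=.
  elim: (enum _) => [|j s IH].
    by under eq_fun do rewrite big_nil; exact: measurable_colsum.
  under eq_fun do rewrite big_cons.
  by apply: measurable_minr => //; exact: measurable_colsum.
rewrite /mx_norm1; under eq_fun do rewrite -big_enum/=.
elim: (enum _) => [|j s IH].
  by under eq_fun do rewrite big_nil; exact: measurable_colsum.
under eq_fun do rewrite big_cons.
by apply: measurable_maxr => //; exact: measurable_colsum.
Qed.

Lemma measurable_set_bool d' (T : measurableType d') (f : T -> bool) :
  measurable_fun setT f -> measurable [set t | f t].
Proof.
move=> mf; have := mf measurableT [set true] I; rewrite setTI.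
by congr measurable; apply/seteqP; split => t /=.
Qed.

Lemma measurable_forall_ord d' (T : measurableType d') n (F : 'I_n -> T -> Prop) :
  (forall i, measurable [set t | F i t]) -> measurable [set t | forall i, F i t].
Proof.
move=> mF; rewrite (_ : mkset _ = \bigcap_(i in [set: 'I_n]) [set t | F i t]).
  by apply: fin_bigcap_measurable => // i _; exact: mF.
by apply/seteqP; split => t /= h; [move=> i _; exact: h|move=> i; exact: h].
Qed.

Lemma measurable_exists_ord d' (T : measurableType d') n (F : 'I_n -> T -> Prop) :
  (forall i, measurable [set t | F i t]) -> measurable [set t | exists i, F i t].
Proof.
move=> mF; rewrite (_ : mkset _ = \bigcup_(i in [set: 'I_n]) [set t | F i t]).
  by apply: fin_bigcup_measurable => // i _; exact: mF.
by apply/seteqP; split => t /= [i]; [exists i|exists i].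
Qed.

Lemma measurable_semiS : measurable (semiS : set G).
Proof.
apply: (@measurableI _ _ [set g : G | forall i j, 0 <= g i j]
  [set g : G | forall j, exists i, 0 < g i j]).
  apply: measurable_forall_ord => i; apply: measurable_forall_ord => j.
  by apply: measurable_set_bool; apply: measurable_fun_ler => //; exact: measurable_coord.
apply: measurable_forall_ord => j; apply: measurable_exists_ord => i.
by apply: measurable_set_bool; apply: measurable_fun_ltr => //; exact: measurable_coord.
Qed.

Lemma measurable_posS : measurable (posS : set G).
Proof.
apply: measurable_forall_ord => i; apply: measurable_forall_ord => j.
by apply: measurable_set_bool; apply: measurable_fun_ltr => //; exact: measurable_coord.
Qed.

Lemma measurable_row_comparable e : measurable (row_comparable e : set G).
Proof.
do 3 (apply: measurable_forall_ord => ?).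
apply: measurable_set_bool; apply: measurable_fun_ler; last exact: measurable_coord.
by apply: measurable_funM => //; exact: measurable_coord.
Qed.

Lemma measurable_simplex : measurable (simplex : set E).
Proof.
apply: (@measurableI _ _ (cone : set E) [set x : E | norm1 x = 1]).
  apply: measurable_forall_ord => i.
  by apply: measurable_set_bool; apply: measurable_fun_ler => //; exact: measurable_coord.
rewrite (_ : mkset _ = [set x : E | norm1 x == 1]).
  by apply: measurable_set_bool; apply: measurable_fun_eqr => //; exact: measurable_norm1.
by apply/seteqP; split => x /= /eqP.
Qed.

Lemma vertex_simplex j : simplex (delta_mx j ord0 : 'cV[R]_d.+1).
Proof.
apply/simplexP; split => [i|]; first by rewrite mxE ler0n.
rewrite /mass (bigD1 j)//= mxE !eqxx big1 ?addr0// => i ij.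
by rewrite mxE (negbTE ij).
Qed.

(** On the simplex |g x| is a convex combination of the column sums, with equality at the vertices.
    The uncountable condition on x in P5 becomes a finite one, hence measurable. *)
Lemma rho_ge_colsum (delta : R) :
  [set g : G | semiS g /\ forall x, simplex x -> delta <= rho g x] =
  [set g : G | semiS g /\ forall j, expR delta <= colsum g j].
Proof.
apply/seteqP; split => g /= [gS h]; split => //.
  move=> j; have := h _ (vertex_simplex j); rewrite /rho.
  rewrite -ler_expR lnK ?posrE ?norm1_mulmx_gt0//; last exact: vertex_simplex.
  rewrite norm1_cone; last by apply: cone_mulmx => //; have [] := vertex_simplex j.
  rewrite mass_mulmx (bigD1 j)//= mxE !eqxx mulr1 big1 ?addr0// => i ij.
  by rewrite mxE (negbTE ij) mulr0.
move=> x xS; rewrite /rho -ler_expR lnK ?posrE ?norm1_mulmx_gt0//.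
rewrite norm1_cone; last by apply: cone_mulmx => //; case: xS.
have /simplexP[x0 x1] := xS.
rewrite mass_mulmx -[leLHS]mulr1 -x1 mulr_sumr; apply: ler_sum => j _.
by rewrite ler_wpM2r.
Qed.

Lemma measurable_rho_ge (delta : R) :
  measurable [set g : G | semiS g /\ forall x, simplex x -> delta <= rho g x].
Proof.
rewrite rho_ge_colsum; apply: (@measurableI _ _ (semiS : set G)
  [set g : G | forall j, expR delta <= colsum g j]); first exact: measurable_semiS.
apply: measurable_forall_ord => j; apply: measurable_set_bool.
by apply: measurable_fun_ler => //; exact: measurable_colsum.
Qed.

End measurability.

(** * Random products and convolution powers *)

Section random_products.
Context {R : realType} {d : nat}.
Local Notation G := (borelM R d).
Local Notation E := (borelV R d).
Context (mu : probability G R).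
Context {dO : measure_display} {Omega : measurableType dO}.
Context (P : probability Omega R) (xi : nat -> Omega -> G).
Hypotheses (hxi : iid_seq mu P xi) (xiS : forall n w, semiS (xi n w)).
Local Notation past n := (g_sigma_algebraType (cylinders xi n)).

Fixpoint mx_prod n w : G := if n is k.+1 then xi k w *m mx_prod k w else 1%:M.

Lemma semiS_mx_prod n w : semiS (mx_prod n w).
Proof.
elim: n => [|n IH] /=; first exact: semiS1.
by apply: semiS_mulmx; first exact: xiS.
Qed.

Lemma measurable_mx_prod_past n k : (k <= n)%N ->
  measurable_fun setT (mx_prod k : past n -> G).
Proof.
elim: k => [_|k IH kn] /=; first exact: measurable_cst.
apply: measurable_mulmx_mat; first exact: measurable_xi_past.
by apply: IH; exact: ltnW.
Qed.

Lemma measurable_mx_prod n : measurable_fun setT (mx_prod n).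
Proof.
by apply: (measurable_of_past hxi (n := n)); exact: measurable_mx_prod_past.
Qed.

(** Both [mconv] and [mx_prod] put the new factor on the left, so the joint law of [xi n] and its
    past unfolds exactly one convolution. *)
Lemma conv_pow_mx_prod n (B : set G) : measurable B ->
  P (mx_prod n @^-1` B) = conv_pow mu n B.
Proof.
elim: n B => [|n IH] B mB.
  rewrite /conv_pow/= /dirac/= indicE.
  have [B1|B1] := pselect (B 1%:M).
    by rewrite mem_set// preimage_cst mem_set// probability_setT.
  by rewrite memNset// preimage_cst memNset// measure0.
pose C := [set t : G * past n | B (t.1 *m mx_prod n t.2)].
have mC : measurable C.
  rewrite -[C]setTI; apply: (measurable_mulmx_mat _ _ measurableT mB) => //.
  exact: (measurableT_comp (measurable_mx_prod_past (leqnn n)) measurable_snd).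
have -> : P (mx_prod n.+1 @^-1` B) = distribution P (xi_now hxi n) C by [].
rewrite -joint_law// /product_measure1 /= /conv_pow /mconv.
apply: eq_integral => g _.
rewrite -[RHS]IH; last first.
  rewrite -[X in measurable X]setTI.
  by apply: (measurable_mulmx_mat _ _ measurableT mB).
by rewrite /distribution /pushforward /=; congr (P _); apply/seteqP; split => w;
  rewrite /xsection /= inE.
Qed.

(** The row-comparable sets of ratios 1 / (k + 1) cover the positive matrices; if the events they
    define were all null, so would be their countable union. *)
Lemma posS_prod_row_comparable n : (0 < conv_pow mu n posS)%E ->
  exists k : nat, (0 < P (mx_prod n @^-1` row_comparable k.+1%:R^-1))%E.
Proof.
move=> c0; apply: contrapT => nex.
have z k : P (mx_prod n @^-1` row_comparable k.+1%:R^-1) = 0%E.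
  apply/eqP; rewrite eq_le measure_ge0 andbT leNgt; apply/negP => pk.
  by apply: nex; exists k.
have mk k : measurable (mx_prod n @^-1` row_comparable k.+1%:R^-1).
  rewrite -[X in measurable X]setTI.
  exact: (@measurable_mx_prod n measurableT _ (measurable_row_comparable _)).
have : (P (mx_prod n @^-1` posS) <=
    P (\bigcup_k (mx_prod n @^-1` row_comparable k.+1%:R^-1)))%E.
  apply: le_measure; rewrite ?inE.
  - rewrite -[X in measurable X]setTI.
    exact: (@measurable_mx_prod n measurableT _ measurable_posS).
  - exact: bigcupT_measurable.
  - by move=> w /= /posS_row_comparable[k hk]; exists k.
rewrite conv_pow_mx_prod; last exact: measurable_posS.
rewrite leNgt; have -> : P (\bigcup_k (mx_prod n @^-1` row_comparable k.+1%:R^-1)) = 0%E.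
  apply: measure_negligible; first exact: bigcupT_measurable.
  by apply: negligible_bigcup => k; apply/(negligibleP P (mk k)); exact: z.
by rewrite c0.
Qed.

End random_products.

(** * The transition operator on the simplex *)

Section projective_chain.
Context {R : realType} {d : nat}.
Local Notation G := (borelM R d).
Local Notation E := (borelV R d).
Local Notation SS := (semiS : set G).
Context (mu : probability G R) (hmu : mu semiS = 1%E).

Definition transition (phi : E -> R) (x : E) : R :=
  \int[mu]_(g in semiS) phi (proj_act g x).

Definition bounded_by (b : R) (phi : E -> R) :=
  measurable_fun setT phi /\ forall x, simplex x -> `|phi x| <= b.

(** Any two points of the simplex are 1-close, so the constant also bounds the oscillation of [phi]
    there. *)
Definition proj_lipschitz (L : R) (phi : E -> R) := forall e x y,
  simplex x -> simplex y -> proj_close e x y -> `|phi x - phi y| <= L * e.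

Lemma measurable_phi_act (phi : E -> R) : measurable_fun setT phi ->
  measurable_fun setT (fun t : G * E => (phi (proj_act t.1 t.2))%:E).
Proof.
move=> mphi; apply/measurable_EFinP.
exact: (measurableT_comp mphi measurable_proj_act).
Qed.

Lemma measurable_phi_act1 (phi : E -> R) (x : E) : measurable_fun setT phi ->
  measurable_fun SS (fun g : G => (phi (proj_act g x))%:E).
Proof.
move=> mphi; apply: measurable_funTS.
exact: (@measurable_fun_pair1 _ _ _ G E _ _ x (measurable_phi_act mphi)).
Qed.

Lemma integrable_phi_act b (phi : E -> R) (x : E) : bounded_by b phi -> simplex x ->
  mu.-integrable SS (fun g : G => (phi (proj_act g x))%:E).
Proof.
move=> [mphi phib] xS.
have ib : mu.-integrable SS (fun=> b%:E).
  by apply: finite_measure_integrable_cst; exact: measurable_semiS.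
apply: le_integrable ib => //; first exact: measurable_semiS.
  exact: measurable_phi_act1.
move=> g gS /=; rewrite lee_fin (le_trans (phib _ _)) ?ler_norm//.
exact: proj_act_simplex.
Qed.

Lemma transition_EFin b (phi : E -> R) (x : E) : bounded_by b phi -> simplex x ->
  (transition phi x)%:E = (\int[mu]_(g in semiS) (phi (proj_act g x))%:E)%E.
Proof.
move=> bphi xS; rewrite /transition /Rintegral fineK//.
apply: integrable_fin_num; first exact: measurable_semiS.
exact: (integrable_phi_act bphi xS).
Qed.

Lemma integral_cst_semiS (b : R) : (\int[mu]_(g in semiS) b%:E = b%:E)%E.
Proof.
rewrite (_ : (\int[mu]_(g in semiS) b%:E)%E = (\int[mu]_(g in semiS) cst b%:E g)%E)//.
rewrite integral_cst; last exact: measurable_semiS.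
by rewrite [X in (_ * X)%E]hmu mule1.
Qed.

Lemma transition_bounded b (phi : E -> R) : bounded_by b phi ->
  bounded_by b (transition phi).
Proof.
move=> bphi; have [mphi phib] := bphi; split.
  rewrite /transition /Rintegral; apply: measurableT_comp => //.
  exact: (measurable_parametric_integral mu measurable_semiS (measurable_phi_act mphi)).
move=> x xS; rewrite -lee_fin -abse_EFin (transition_EFin bphi xS).
apply: le_trans (le_abse_integral _ _ _) _; first exact: measurable_semiS.
  exact: measurable_phi_act1.
rewrite -(integral_cst_semiS b); apply: ge0_le_integral => //.
- exact: measurable_semiS.
- by apply: measurableT_comp => //; exact: measurable_phi_act1.
- move=> g gS /=; rewrite lee_fin; apply: phib; exact: proj_act_simplex.
Qed.

Lemma iter_transition_bounded b n (phi : E -> R) : bounded_by b phi ->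
  bounded_by b (iter n transition phi).
Proof. by move=> bphi; elim: n => //= n; exact: transition_bounded. Qed.

Section along_path.
Context {dO : measure_display} {Omega : measurableType dO}.
Context (P : probability Omega R) (xi : nat -> Omega -> G).
Hypotheses (hxi : iid_seq mu P xi) (xiS : forall n w, semiS (xi n w)).
Local Notation past n := (g_sigma_algebraType (cylinders xi n)).

Lemma iter_transitionE b n (phi : E -> R) (x : E) : bounded_by b phi -> simplex x ->
  P.-integrable setT (fun w => (phi (proj_act (mx_prod xi n w) x))%:E) /\
  (\int[P]_w (phi (proj_act (mx_prod xi n w) x))%:E = (iter n transition phi x)%:E)%E.
Proof.
move=> bphi xS; elim: n phi bphi => [|n IH] phi bphi.
  rewrite /= proj_act1//; split; first exact: finite_measure_integrable_cst.
  transitivity (\int[P]_w (cst (phi x)%:E w))%E => //.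
  by rewrite integral_cst//= probability_setT mule1.
have [mphi phib] := bphi.
have step w : proj_act (mx_prod xi n.+1 w) x =
    proj_act (xi n w) (proj_act (mx_prod xi n w) x).
  by rewrite /= proj_actM//; exact: semiS_mx_prod.
pose f (t : G * past n) := phi (proj_act t.1 (proj_act (mx_prod xi n t.2) x)).
have mf : measurable_fun setT f.
  apply: (measurableT_comp mphi).
  have mX : measurable_fun setT (fun w : past n => (proj_act (mx_prod xi n w) x : E)).
    have mp : measurable_fun setT (fun w : past n => (mx_prod xi n w, x : E)).
      by apply: measurable_fun_pair => //; exact: measurable_mx_prod_past.
    exact: (measurableT_comp measurable_proj_act mp).
  have mp : measurable_fun setT
      (fun t : G * past n => (t.1, (proj_act (mx_prod xi n t.2) x : E))).
    apply: measurable_fun_pair => //; exact: (measurableT_comp mX measurable_snd).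
  exact: (measurableT_comp measurable_proj_act mp).
have ib : mu.-integrable SS (EFin \o cst b).
  by apply: finite_measure_integrable_cst; exact: measurable_semiS.
have fb g w : semiS g -> `|f (g, w)| <= cst b g.
  move=> gS; apply: phib; apply: proj_act_simplex => //; apply: proj_act_simplex => //.
  exact: semiS_mx_prod.
have [i1 e1] := indep_integral hxi measurable_semiS (xiS n) mf ib fb.
have -> : (fun w => (phi (proj_act (mx_prod xi n.+1 w) x))%:E) =
    (fun w => (f (xi n w, w))%:E).
  by apply/funext => w; rewrite step.
split => //; rewrite e1 iterSr.
have [_ <-] := IH _ (transition_bounded bphi).
apply: eq_integral => w _; rewrite (transition_EFin bphi)//.
by apply: proj_act_simplex => //; exact: semiS_mx_prod.
Qed.

Lemma transition_lipschitz b L (phi : E -> R) : bounded_by b phi ->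
  proj_lipschitz L phi -> proj_lipschitz L (transition phi).
Proof.
move=> bphi Lphi e x y xS yS cl; rewrite -lee_fin -abse_EFin EFinB.
have mS := @measurable_semiS R d.
have ix := integrable_phi_act bphi xS; have iy := integrable_phi_act bphi yS.
rewrite !(transition_EFin bphi)// -integralB//.
apply: le_trans (le_abse_integral _ _ _) _ => //.
  by apply: emeasurable_funB; [exact: measurable_int ix|exact: measurable_int iy].
rewrite -(integral_cst_semiS (L * e)); apply: ge0_le_integral => //.
- apply: measurableT_comp => //.
  by apply: emeasurable_funB; [exact: measurable_int ix|exact: measurable_int iy].
- move=> g gS; rewrite -EFinB abse_EFin lee_fin; apply: Lphi.
  + exact: proj_act_simplex.
  + exact: proj_act_simplex.
  + exact: proj_close_act0.
Qed.

(** With probability q > 0 the product of n matrices is row comparable with ratio c and shrinks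
    closeness by 1 - c^2; in all cases it does not worsen it. The mean factor is thus 1 - c^2 q. *)
Lemma iter_transition_contract n : (0 < conv_pow mu n posS)%E ->
  exists kappa : R, 0 < kappa < 1 /\ forall b L (phi : E -> R), 0 <= L ->
    bounded_by b phi -> proj_lipschitz L phi ->
    proj_lipschitz (kappa * L) (iter n transition phi).
Proof.
move=> /(posS_prod_row_comparable hxi)[k Pk].
set A := mx_prod xi n @^-1` _ in Pk.
pose c : R := k.+1%:R^-1.
have c0 : 0 < c by rewrite invr_gt0.
have c1 : c <= 1 by rewrite invf_le1// ler1n.
have mA : measurable A.
  rewrite -[X in measurable X]setTI.
  exact: (measurable_mx_prod hxi n measurableT (measurable_row_comparable _)).
pose q := fine (P A).
have q0 : 0 < q by rewrite /q fine_gt0// Pk ltey_eq fin_num_measure.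
have q1 : q <= 1 by rewrite -lee_fin /q fineK ?fin_num_measure// probability_le1.
have cc0 : 0 < c ^+ 2 by rewrite exprn_gt0.
have cc1 : c ^+ 2 <= 1 by rewrite expr_le1// ltW.
(* Halving [c ^+ 2 * q] keeps the factor positive even when c = q = 1. *)
exists (1 - c ^+ 2 * q / 2); split.
  have : 0 < c ^+ 2 * q by rewrite mulr_gt0.
  have : c ^+ 2 * q <= 1 by rewrite mulr_ile1// ltW.
  by move=> ? ?; apply/andP; split; lra.
move=> b L phi L0 bphi Lphi e x y xS yS cl.
have e0 := proj_close_ge0 xS yS cl.
have [ix ex] := iter_transitionE n bphi xS.
have [iy ey] := iter_transitionE n bphi yS.
rewrite -lee_fin -abse_EFin EFinB -ex -ey -integralB//.
apply: le_trans (le_abse_integral _ _ _) _ => //.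
  by apply: emeasurable_funB; [exact: measurable_int ix|exact: measurable_int iy].
apply: (@le_trans _ _ (\int[P]_w (L * e - L * e * c ^+ 2 * \1_A w)%:E)%E).
  apply: ge0_le_integral => //.
  - apply: measurableT_comp => //.
    by apply: emeasurable_funB; [exact: measurable_int ix|exact: measurable_int iy].
  - apply/measurable_EFinP; apply: measurable_funB => //.
    by apply: measurable_funM => //; exact: measurable_indic.
  move=> w _; rewrite -EFinB abse_EFin lee_fin.
  have gS := semiS_mx_prod xiS n w.
  have [wA|wA] := pselect (A w).
    rewrite indicE mem_set// mulr1.
    have -> : L * e - L * e * c ^+ 2 = L * ((1 - c ^+ 2) * e) by ring.
    apply: Lphi; [exact: proj_act_simplex|exact: proj_act_simplex|].
    by apply: proj_close_act => //; rewrite (ltW c0) c1.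
  rewrite indicE memNset// mulr0 subr0.
  apply: Lphi; [exact: proj_act_simplex|exact: proj_act_simplex|].
  exact: proj_close_act0.
have i1 : P.-integrable setT (fun=> (L * e)%:E).
  exact: finite_measure_integrable_cst.
have i2 : P.-integrable setT (fun w => (L * e * c ^+ 2)%:E * (\1_A w)%:E)%E.
  by apply: integrableZl => //; exact: integrable_indic.
rewrite -[leLHS]/(\int[P]_w ((fun=> (L * e)%:E) \-
  (fun w => (L * e * c ^+ 2)%:E * (\1_A w)%:E)) w)%E.
rewrite (integralB measurableT i1 i2) integralZl//; last exact: integrable_indic.
rewrite integral_indic// setIT.
have -> : (\int[P]_x (L * e)%:E = (L * e)%:E)%E.
  transitivity (\int[P]_w (cst (L * e)%:E w))%E => //.
  by rewrite integral_cst//= probability_setT mule1.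
have PA : P A = q%:E by rewrite /q fineK// fin_num_measure.
rewrite [X in (_ - _ * X)%E]PA -EFinM -EFinB lee_fin.
have : 0 <= c ^+ 2 * q * (L * e) by rewrite !mulr_ge0// ltW.
lra.
Qed.

End along_path.

End projective_chain.

(** * Fubini's theorem with a bound depending on one variable *)

Section dominated_fubini.
Context {R : realType} {d1 d2 : measure_display}.
Context {T1 : measurableType d1} {T2 : measurableType d2}.
Context (m1 : probability T1 R) (m2 : probability T2 R).

Lemma dominated_fubini (D1 : set T1) (D2 : set T2) (f : T1 * T2 -> R) (k : T1 -> R) :
  measurable D1 -> measurable D2 -> measurable_fun setT f ->
  m1.-integrable D1 (EFin \o k) ->
  (forall x y, D1 x -> D2 y -> `|f (x, y)| <= k x) ->
  (\int[m1]_(x in D1) \int[m2]_(y in D2) (f (x, y))%:E =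
   \int[m2]_(y in D2) \int[m1]_(x in D1) (f (x, y))%:E)%E.
Proof.
move=> mD1 mD2 mf ik fk.
have mD : measurable (D1 `*` D2) by exact: measurableX.
pose F := (EFin \o f) \_ (D1 `*` D2).
have mF : measurable_fun setT F.
  apply/(measurable_restrictT (EFin \o f) mD); apply: measurable_funTS.
  exact/measurable_EFinP.
(* A point of [D2] is needed to deduce that k is non-negative on [D1]. *)
have [D20|/set0P[y0 D2y0]] := eqVneq D2 set0.
  rewrite D20 integral_set0; apply: integral0_eq => x _.
  by rewrite integral_set0.
have k0 x : D1 x -> 0 <= k x by move=> Dx; rewrite (le_trans _ (fk x y0 Dx D2y0)).
have F1 x : (\int[m2]_y F (x, y) =
    if x \in D1 then \int[m2]_(y in D2) (f (x, y))%:E else 0)%E.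
  case: ifPn => xD.
    rewrite [RHS]integral_mkcond; apply: eq_integral => y _; rewrite /F !patchE.
    rewrite inE in xD; have [yD|yD] := pselect (D2 y); first by rewrite !mem_set.
    by rewrite !memNset// => -[].
  apply: integral0_eq => y _; rewrite /F patchE ifF//; apply/negP.
  by rewrite inE /= => -[]; rewrite notin_setE in xD.
have F2 y : (\int[m1]_x F (x, y) =
    if y \in D2 then \int[m1]_(x in D1) (f (x, y))%:E else 0)%E.
  case: ifPn => yD.
    rewrite [RHS]integral_mkcond; apply: eq_integral => x _; rewrite /F !patchE.
    rewrite inE in yD; have [xD|xD] := pselect (D1 x); first by rewrite !mem_set.
    by rewrite !memNset// => -[].
  apply: integral0_eq => x _; rewrite /F patchE ifF//; apply/negP.
  by rewrite inE /= => -[]; rewrite notin_setE in yD.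
have iF : (m1 \x m2)%E.-integrable setT F.
  apply/integrable12ltyP => //.
  apply: (@le_lt_trans _ _ (\int[m1]_(x in D1) (k x)%:E)%E); last first.
    exact: integrable_lty ik.
  rewrite [leRHS]integral_mkcond; apply: ge0_le_integral => //.
  - by move=> x _; exact: integral_ge0.
  - apply: (measurable_fun_fubini_tonelli_F (abse \o F)) => //.
      exact: measurableT_comp.
    by move=> t /=.
  - by apply/(measurable_restrictT (EFin \o k) mD1); exact: measurable_int ik.
  move=> x _; rewrite patchE; case: ifPn => xD; last first.
    rewrite integral0_eq// => y _; rewrite /F patchE ifF ?abse0//; apply/negP.
    by rewrite inE /= => -[]; rewrite notin_setE in xD.
  have <- : (\int[m2]_y cst (k x)%:E y = (k x)%:E)%E.
    by rewrite integral_cst//= probability_setT mule1.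
  rewrite inE in xD; apply: ge0_le_integral => //.
  - by apply: measurableT_comp => //; exact: (measurable_fun_pair2 x mF).
  - move=> y _; rewrite /F patchE; case: ifPn => [|_].
      by rewrite inE => -[/= _ yD]; rewrite lee_fin; exact: fk.
    by rewrite abse0 lee_fin k0.
have := Fubini iF.
under eq_integral do rewrite F1.
under [in X in _ = X -> _]eq_integral do rewrite F2.
rewrite (integral_mkcond D1) (integral_mkcond D2) => e.
transitivity (\int[m1]_x (if x \in D1 then \int[m2]_(y in D2) (f (x, y))%:E else 0))%E.
  by apply: eq_integral => x _; rewrite patchE.
by rewrite e; apply: eq_integral => y _; rewrite patchE.
Qed.

End dominated_fubini.

(** * Decay of the averages and the Poisson equation *)

Section poisson_equation.
Context {R : realType} {d : nat}.
Local Notation G := (borelM R d).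
Local Notation E := (borelV R d).
Local Notation SS := (semiS : set G).
Local Notation SX := (simplex : set E).
Context (mu : probability G R) (nu : probability E R).
Hypotheses (hmu : mu semiS = 1%E) (hnu : mu_invariant mu nu) (hP4 : hypP4 mu nu).
Hypothesis ilnN : mu.-integrable SS (fun g => (ln (mx_N g))%:E).

Definition mean_rho (x : E) : R := \int[mu]_(g in semiS) rho g x.

Let K := \int[mu]_(g in SS) ln (mx_N g).

Let KE : (K%:E = \int[mu]_(g in SS) (ln (mx_N g))%:E)%E.
Proof.
rewrite /K /Rintegral fineK//; apply: integrable_fin_num => //.
exact: measurable_semiS.
Qed.

Let mS := @measurable_semiS R d.
Let mX := @measurable_simplex R d.

Let lnN_ge0 (g : G) : semiS g -> 0 <= ln (mx_N g).
Proof. by move=> gS; rewrite ln_ge0// mx_N_ge1. Qed.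

Let K_ge0 : 0 <= K.
Proof. by rewrite -lee_fin KE; apply: integral_ge0 => g gS; rewrite lee_fin lnN_ge0. Qed.

Let measurable_rho1 (x : E) : measurable_fun SS (fun g : G => (rho g x)%:E).
Proof.
apply/measurable_EFinP; apply: measurable_funTS.
exact: (@measurable_fun_pair1 _ _ _ G E _ _ x measurable_rho_pair).
Qed.

Let integrable_rho (x : E) : simplex x -> mu.-integrable SS (fun g : G => (rho g x)%:E).
Proof.
move=> xS; apply: le_integrable ilnN => // g gS /=.
by rewrite lee_fin (le_trans (rho_le_lnN gS xS)) ?ler_norm.
Qed.

Let mean_rhoE (x : E) : simplex x ->
  (mean_rho x)%:E = (\int[mu]_(g in SS) (rho g x)%:E)%E.
Proof.
move=> xS; rewrite /mean_rho /Rintegral fineK//; apply: integrable_fin_num => //.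
exact: integrable_rho.
Qed.

Lemma mean_rho_bounded : bounded_by K mean_rho.
Proof.
split.
  rewrite /mean_rho /Rintegral; apply: measurableT_comp => //.
  apply: (measurable_parametric_integral mu (h := fun t : G * E => (rho t.1 t.2)%:E)) => //.
  by apply/measurable_EFinP; exact: measurable_rho_pair.
move=> x xS; rewrite -lee_fin -abse_EFin (mean_rhoE xS) KE.
apply: le_trans (le_abse_integral _ _ _) _ => //.
apply: ge0_le_integral => //.
- exact: measurableT_comp.
- exact: measurable_int ilnN.
- by move=> g gS; rewrite lee_fin; exact: rho_le_lnN.
Qed.

Lemma mean_rho_lipschitz : proj_lipschitz (2 + 4 * K) mean_rho.
Proof.
move=> e x y xS yS cl; rewrite -lee_fin -abse_EFin EFinB.
have ix := integrable_rho xS; have iy := integrable_rho yS.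
rewrite (mean_rhoE xS) (mean_rhoE yS) -integralB//.
apply: le_trans (le_abse_integral _ _ _) _ => //.
  by apply: emeasurable_funB; exact: measurable_rho1.
have e0 := proj_close_ge0 xS yS cl.
have i1 : mu.-integrable SS (fun=> (2 * e)%:E) by exact: finite_measure_integrable_cst.
have i2 : mu.-integrable SS (fun g => (4 * e)%:E * (ln (mx_N g))%:E)%E.
  exact: integrableZl.
apply: (@le_trans _ _ (\int[mu]_(g in SS) (((fun=> (2 * e)%:E) \+
    (fun g => (4 * e)%:E * (ln (mx_N g))%:E)) g)))%E.
  apply: ge0_le_integral => //.
  - apply: measurableT_comp => //.
    by apply: emeasurable_funB; exact: measurable_rho1.
  - by apply: emeasurable_funD; [exact: measurable_int i1|exact: measurable_int i2].
  move=> g gS; rewrite -EFinB abse_EFin /= -EFinM -EFinD lee_fin.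
  by apply: le_trans (rho_close gS xS yS cl) _; rewrite mulrDl mulrAC.
rewrite integralD// integralZl// integral_cst_semiS// -KE -EFinM -EFinD lee_fin.
by rewrite le_eqVlt; apply/orP; left; apply/eqP; ring.
Qed.

Lemma integral_transition b (phi : E -> R) : bounded_by b phi ->
  (\int[nu]_(x in SX) (transition mu phi x)%:E = \int[nu]_(x in SX) (phi x)%:E)%E.
Proof.
move=> bphi; have [mphi phib] := bphi; have [nuX inv] := hnu.
have mphiX : measurable_fun SX phi by exact: measurable_funTS.
rewrite -(inv phi mphiX (ex_intro _ b phib)).
transitivity (\int[nu]_(x in SX) \int[mu]_(g in SS) (phi (proj_act g x))%:E)%E.
  by apply: eq_integral => x; rewrite inE => xS; rewrite (transition_EFin mu bphi).
apply/esym; apply: (@dominated_fubini _ _ _ G E mu nu SS SX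
  (fun t : G * E => phi (proj_act t.1 t.2)) (cst b)) => //.
- exact: (measurableT_comp mphi measurable_proj_act).
- exact: finite_measure_integrable_cst.
- by move=> g x gS xS; apply: phib; exact: proj_act_simplex.
Qed.

(** P4 is the case n = 0 after exchanging the integrals; the invariance of nu propagates it. *)
Lemma integral_iter_mean_rho n :
  (\int[nu]_(x in SX) (iter n (transition mu) mean_rho x)%:E = 0)%E.
Proof.
elim: n => [|n IH]; last first.
  by rewrite iterS (integral_transition (iter_transition_bounded hmu n mean_rho_bounded)).
rewrite /= -hP4 /upper_lyapunov.
transitivity (\int[nu]_(x in SX) \int[mu]_(g in SS) (rho g x)%:E)%E.
  by apply: eq_integral => x; rewrite inE => xS; rewrite mean_rhoE.
apply/esym; apply: (@dominated_fubini _ _ _ G E mu nu SS SX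
  (fun t : G * E => rho t.1 t.2) (fun g => ln (mx_N g))) => //.
- exact: measurable_rho_pair.
- by move=> g x gS xS; exact: rho_le_lnN.
Qed.

(** The nu-mean is 0 and any two points of the simplex are 1-close, so the Lipschitz constant bounds
    the oscillation and with it the supremum. *)
Lemma iter_mean_rho_le n L x : proj_lipschitz L (iter n (transition mu) mean_rho) ->
  simplex x -> `|iter n (transition mu) mean_rho x| <= L.
Proof.
set c := iter n (transition mu) mean_rho => Lc xS.
have [mc cb] := iter_transition_bounded hmu n mean_rho_bounded.
have [nuX _] := hnu.
have mcE : measurable_fun SX (fun y : E => (c y)%:E).
  by apply/measurable_EFinP; exact: measurable_funTS.
have ic : nu.-integrable SX (fun y : E => (c y)%:E).
  have iK : nu.-integrable SX (fun=> K%:E) by exact: finite_measure_integrable_cst.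
  apply: le_integrable iK => // y yS /=.
  by rewrite lee_fin (le_trans (cb y yS)) ?ler_norm.
have ix : nu.-integrable SX (fun=> (c x)%:E) by exact: finite_measure_integrable_cst.
have cstE (b : R) : (\int[nu]_(y in SX) b%:E = b%:E)%E.
  transitivity (\int[nu]_(y in SX) (cst b%:E y))%E => //.
  by rewrite integral_cst// [X in (_ * X)%E]nuX mule1.
have e : (\int[nu]_(y in SX) ((fun y => (c y)%:E) \- (fun=> (c x)%:E)) y = - (c x)%:E)%E.
  by rewrite integralB// cstE integral_iter_mean_rho sub0e.
rewrite -normrN -lee_fin -abse_EFin EFinN -e -(cstE L).
apply: le_trans (le_abse_integral _ _ _) _ => //.
  by apply: emeasurable_funB => //; exact: measurable_int ix.
apply: ge0_le_integral => //.
- by apply: measurableT_comp => //; apply: emeasurable_funB => //; exact: measurable_int ix.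
- move=> y yS; rewrite -EFinB abse_EFin lee_fin -[L]mulr1; apply: Lc => //.
  exact: proj_close1.
Qed.

Section decay.
Context {dO : measure_display} {Omega : measurableType dO}.
Context (P : probability Omega R) (xi : nat -> Omega -> G).
Hypotheses (hxi : iid_seq mu P xi) (xiS : forall n w, semiS (xi n w)).

(** Only whole blocks of n0 steps contract; the remaining n %% n0 steps leave the Lipschitz constant
    unchanged. *)
Lemma mean_rho_decay n0 : (0 < n0)%N -> (0 < conv_pow mu n0 posS)%E ->
  exists C r : R, [/\ 0 <= C, 0 < r < 1 & forall n (x : E), simplex x ->
    `|iter n (transition mu) mean_rho x| <= C * r ^+ n].
Proof.
move=> n0p /(iter_transition_contract hmu hxi xiS)[kappa [/andP[k0 k1] contract]].
pose L := 2 + 4 * K.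
have L0 : 0 <= L by rewrite addr_ge0// mulr_ge0.
have lip q : proj_lipschitz (kappa ^+ q * L) (iter (q * n0) (transition mu) mean_rho).
  elim: q => [|q IH]; first by rewrite expr0 mul1r; exact: mean_rho_lipschitz.
  rewrite mulSn iterD exprS -mulrA.
  apply: contract IH; first by rewrite mulr_ge0 ?exprn_ge0// ltW.
  exact: (iter_transition_bounded hmu _ mean_rho_bounded).
have lipn n : proj_lipschitz (kappa ^+ (n %/ n0) * L) (iter n (transition mu) mean_rho).
  rewrite {2}(divn_eq n n0) addnC iterD; elim: (n %% n0)%N => [|k IH]; first exact: lip.
  rewrite iterS; apply: (transition_lipschitz hmu _ IH).
  rewrite -iterD; exact: (iter_transition_bounded hmu _ mean_rho_bounded).
have n0R : 0 < n0%:R :> R by rewrite ltr0n.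
(* Bernoulli's inequality gives r ^+ n0 >= kappa, a substitute for the n0-th root of kappa; the
   incomplete block is absorbed in the constant L / r ^+ n0. *)
pose r := 1 - (1 - kappa) / n0%:R.
have dr : (1 - kappa) / n0%:R <= 1 - kappa.
  have n1 : 1 <= n0%:R :> R by rewrite ler1n.
  by rewrite ler_pdivrMr// ler_peMr// subr_ge0 ltW.
have r0 : 0 < r by rewrite /r; lra.
have r1 : r < 1 by rewrite /r ltrBlDr ltrDl divr_gt0// subr_gt0.
have kr : kappa <= r ^+ n0.
  have bern k : 1 - k%:R * ((1 - kappa) / n0%:R) <= r ^+ k.
    elim: k => [|k IH]; first by rewrite mul0r subr0 expr0.
    rewrite exprS; apply: le_trans (ler_wpM2l (ltW r0) IH).
    have : 0 <= k%:R * ((1 - kappa) / n0%:R) * ((1 - kappa) / n0%:R).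
      by rewrite !mulr_ge0// ?divr_ge0 ?subr_ge0// ltW.
    rewrite /r -natr1; lra.
  by have := bern n0; rewrite mulrC divfK ?gt_eqF// subKr.
exists (L / r ^+ n0), r; split.
- by rewrite divr_ge0// exprn_ge0// ltW.
- by rewrite r0 r1.
move=> n x xS; apply: le_trans (iter_mean_rho_le (lipn n) xS) _.
rewrite mulrC -mulrA ler_wpM2l// mulrC ler_pdivlMr ?exprn_gt0//.
apply: (@le_trans _ _ (r ^+ (n %/ n0 * n0 + n %% n0))); last by rewrite -divn_eq.
apply: (@le_trans _ _ (r ^+ (n %/ n0 * n0 + n0))); last first.
  by apply: ler_wiXn2l; rewrite ?(ltW r0) ?(ltW r1)// leq_add2l ltnW// ltn_pmod.
rewrite exprD ler_pM2r ?exprn_gt0// mulnC exprM.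
by apply: lerXn2r; rewrite ?nnegrE ?exprn_ge0// ltW.
Qed.

End decay.

(** The transition operator maps a partial sum to the next one minus the first term; dominated
    convergence turns this into P h = h - [mean_rho]. *)
Lemma poisson_solution (C r : R) : 0 <= C -> 0 < r < 1 ->
  (forall n (x : E), simplex x -> `|iter n (transition mu) mean_rho x| <= C * r ^+ n) ->
  exists (h : E -> R) (B : R), [/\ measurable_fun setT h, (forall x, `|h x| <= B),
    (forall x, simplex x ->
      series (fun n => iter n (transition mu) mean_rho x) n @[n --> \oo] --> h x) &
    (forall x, simplex x ->
      (\int[mu]_(g in SS) (rho g x + h (proj_act g x) - h x)%:E = 0)%E)].
Proof.
move=> C0 /andP[r0 r1] decay.
have itb n := iter_transition_bounded hmu n mean_rho_bounded.
(* Set to 0 off the simplex, so that the series converges and is bounded at every point. *)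
pose u n (x : E) := if x \in SX then iter n (transition mu) mean_rho x else 0.
have uX n (x : E) : simplex x -> u n x = iter n (transition mu) mean_rho x.
  by move=> xS; rewrite /u mem_set.
have ub n x : `|u n x| <= C * r ^+ n.
  rewrite /u; case: ifPn; first by rewrite inE; exact: decay.
  by rewrite normr0 mulr_ge0// exprn_ge0// ltW.
have mX' : measurable_fun setT (fun x : E => x \in SX).
  apply: (measurable_fun_bool true); rewrite setTI.
  rewrite (_ : _ @^-1` _ = SX)//; apply/seteqP; split => x /=; first by move=> /set_mem.
  by move=> xS; rewrite mem_set.
have mu_ n : measurable_fun setT (u n).
  by apply: measurable_fun_ifT => //; have [] := itb n.
pose B := C / (1 - r).
have r1' : 0 < 1 - r by rewrite subr_gt0.
have geo n : \sum_(0 <= k < n) C * r ^+ k <= B.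
  suff <- : \sum_(0 <= k < n) C * r ^+ k + B * r ^+ n = B.
    by rewrite lerDl mulr_ge0 ?divr_ge0 ?exprn_ge0// ltW.
  elim: n => [|n IH]; first by rewrite big_geq// expr0 mulr1 add0r.
  rewrite big_nat_recr//= -[RHS]IH -addrA; congr (_ + _).
  by rewrite exprS /B; field; rewrite gt_eqF.
have sb n x : `|series (u^~ x) n| <= B.
  apply: le_trans (geo n); rewrite /series/=; apply: le_trans (ler_norm_sum _ _ _) _.
  by apply: ler_sum => k _; exact: ub.
have cvu x : cvgn (series (u^~ x)).
  apply: normed_cvg; apply: (series_le_cvg (v_ := fun n => C * r ^+ n)).
  - by move=> n /=.
  - by move=> n; rewrite mulr_ge0// exprn_ge0// ltW.
  - by move=> n; exact: ub.
  - apply: nondecreasing_is_cvgn.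
      apply/nondecreasing_seqP => n; rewrite !seriesEnat/= big_nat_recr//= lerDl.
      by rewrite mulr_ge0// exprn_ge0// ltW.
    by exists B => _ [n _ <-]; exact: geo.
pose h (x : E) : R := limn (series (u^~ x)).
have hcv x : series (u^~ x) n @[n --> \oo] --> h x by exact: cvu.
have ms n : measurable_fun setT (fun x => series (u^~ x) n).
  by rewrite /series/=; apply: measurable_sum => k; exact: mu_.
have mh : measurable_fun setT h.
  by apply: (measurable_fun_cvg (h := fun n x => series (u^~ x) n)) => // x _; exact: hcv.
have hB x : `|h x| <= B.
  have c : `|series (u^~ x) n| @[n --> \oo] --> `|h x|.
    by apply: cvg_norm; exact: hcv.
  rewrite -(cvg_lim _ c)//; apply: limr_le; first by apply/cvg_ex; exists `|h x|.
  by apply: nearW => n; exact: sb.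
have seriesX x : simplex x ->
    series (u^~ x) = series (fun n => iter n (transition mu) mean_rho x).
  move=> xS; apply/funext => n; rewrite /series/=.
  by apply: eq_bigr => k _; exact: uX.
exists h, B; split => //.
  by move=> x xS; rewrite -seriesX//; exact: hcv.
move=> x xS.
have iu n : mu.-integrable SS (fun g => (u n (proj_act g x))%:E).
  by apply: (@integrable_phi_act _ _ mu (C * r ^+ n) (u n)).
have is_ n : mu.-integrable SS (fun g => (series (u^~ (proj_act g x)) n)%:E).
  apply: (@integrable_phi_act _ _ mu B (fun y : E => series (u^~ y) n)).
  - by split.
  - by [].
have ih : mu.-integrable SS (fun g => (h (proj_act g x))%:E).
  exact: (@integrable_phi_act _ _ mu B h x (conj mh (fun y _ => hB y)) xS).
have eqs n : (\int[mu]_(g in SS) (series (u^~ (proj_act g x)) n)%:E =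
    (series (u^~ x) n.+1 - mean_rho x)%:E)%E.
  elim: n => [|n IH].
    rewrite /series/= big_nat1 uX//= subrr.
    by apply: integral0_eq => g _; rewrite big_geq.
  transitivity (\int[mu]_(g in SS) (((fun g => (series (u^~ (proj_act g x)) n)%:E) \+
      (fun g => (u n (proj_act g x))%:E)) g))%E.
    by apply: eq_integral => g _; rewrite /series/= big_nat_recr//= EFinD.
  rewrite integralD// IH.
  have -> : (\int[mu]_(g in SS) (u n (proj_act g x))%:E = (u n.+1 x)%:E)%E.
    rewrite uX// iterS (transition_EFin mu (itb n) xS).
    apply: eq_integral => g; rewrite inE => gS; rewrite uX//.
    exact: proj_act_simplex.
  rewrite -EFinD; congr EFin.
  by rewrite [in RHS]/series/= [in RHS]big_nat_recr//= addrAC.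
have lim1 : (\int[mu]_(g in SS) (series (u^~ (proj_act g x)) n)%:E)%E @[n --> \oo]
    --> (\int[mu]_(g in SS) (h (proj_act g x))%:E)%E.
  apply: (@dominated_cvg _ _ _ mu SS mS
    (fun n g => (series (u^~ (proj_act g x)) n)%:E)
    (fun g => (h (proj_act g x))%:E) (cst B%:E)) => //.
  - by move=> n; exact: measurable_int (is_ n).
  - by move=> g gS; apply: cvg_EFin; [exact: nearW|exact: hcv].
  - exact: finite_measure_integrable_cst.
  - by move=> n g gS; rewrite /= lee_fin.
have lim2 : (\int[mu]_(g in SS) (series (u^~ (proj_act g x)) n)%:E)%E @[n --> \oo]
    --> (h x - mean_rho x)%:E.
  apply: cvg_EFin; first by apply: nearW => n; rewrite eqs.
  rewrite (_ : fine \o _ = fun n => series (u^~ x) n.+1 - mean_rho x); last first.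
    by apply/funext => n /=; rewrite eqs.
  apply: cvgB; last exact: cvg_cst.
  by have := hcv x; rewrite -cvg_shiftS.
have eh : (\int[mu]_(g in SS) (h (proj_act g x))%:E = (h x - mean_rho x)%:E)%E.
  by rewrite -(cvg_lim _ lim1)// (cvg_lim _ lim2).
have ic : mu.-integrable SS (fun=> (h x)%:E) by exact: finite_measure_integrable_cst.
have ir := integrable_rho xS.
transitivity (\int[mu]_(g in SS) ((((fun g : G => (rho g x)%:E) \+
  (fun g => (h (proj_act g x))%:E)) \- (fun=> (h x)%:E)) g))%E => //.
rewrite integralB//; last exact: integrableD.
rewrite integralD// eh integral_cst_semiS// -(mean_rhoE xS) -EFinD.
by congr EFin; ring.
Qed.

End poisson_equation.

(** * From the abstract killed walk to the process of the theorem *)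

Section conclusion.
Context {R : realType} {d : nat}.
Local Notation G := (borelM R d).
Local Notation E := (borelV R d).
Local Notation SS := (semiS : set G).
Local Notation act := (proj_act : G -> E -> E).
Local Notation rh := (rho : G -> E -> R).
Context (mu : probability G R) (hmu : mu semiS = 1%E).

Lemma integrable_mx_N (e : R) :
  (\int[mu]_(g in semiS) ((mx_N g) `^ e)%:E < +oo)%E ->
  mu.-integrable SS (fun g => (expR (e * ln (mx_N g)))%:E).
Proof.
move=> hN; have mS := @measurable_semiS R d.
apply/integrableP; split.
  apply/measurable_EFinP; apply: measurable_funTS; apply: measurableT_comp => //.
  apply: measurable_funM => //; apply: measurableT_comp => //.
  exact: measurable_mx_N.
apply: le_lt_trans hN; rewrite le_eqVlt; apply/orP; left; apply/eqP.
apply: eq_integral => g; rewrite inE => gS.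
rewrite gee0_abs ?lee_fin ?expR_ge0// /powR gt_eqF//.
by rewrite (lt_le_trans ltr01)// mx_N_ge1.
Qed.

Lemma integrable_ln_mx_N (e : R) : 0 < e ->
  mu.-integrable SS (fun g => (expR (e * ln (mx_N g)))%:E) ->
  mu.-integrable SS (fun g => (ln (mx_N g))%:E).
Proof.
move=> e0 iN; have mS := @measurable_semiS R d.
have := integrableZl mS e^-1 iN; apply: le_integrable => //.
  apply/measurable_EFinP; apply: measurable_funTS; apply: measurableT_comp => //.
  exact: measurable_mx_N.
move=> g gS /=; have l0 : 0 <= ln (mx_N g) by rewrite ln_ge0// mx_N_ge1.
rewrite lee_fin ger0_norm// ger0_norm; last first.
  by rewrite mulr_ge0 ?expR_ge0// invr_ge0 ltW.
rewrite mulrC ler_pdivlMr// mulrC (le_trans _ (expR_ge1Dx _))//.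
by rewrite lerDr.
Qed.

(** One application of [Pbar] turns rho into [mean_rho] and keeps g and x only through g.x. *)
Lemma iter_PbarE n g x :
  iter n.+1 (Pbar mu) rho g x = iter n (transition mu) (mean_rho mu) (proj_act g x).
Proof.
elim: n g x => [|n IH] g x //.
by rewrite iterS {1}/Pbar; under eq_Rintegral do rewrite IH.
Qed.

Section process.
Context {dO : measure_display} {Omega : measurableType dO}.
Context (P : probability Omega R) (xi : nat -> {RV P >-> G}).
Hypothesis hxi : iid_with_law mu xi.
Let xs n : Omega -> G := xi n.

Lemma iid_with_law_seq : iid_seq mu P xs.
Proof. by case: hxi => _ law ind; split => // n; exact: measurable_funPT. Qed.

Lemma iid_with_law_semiS n w : semiS (xs n w).
Proof. by case: hxi => xiS _ _; exact: xiS. Qed.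

Lemma semiS_gmat n w : semiS (gmat xi n w).
Proof. by case: n => [|n] /=; [exact: semiS1|exact: iid_with_law_semiS]. Qed.

Lemma semiS_gprod n w : semiS (gprod xi n w).
Proof.
elim: n => [|n IH] /=; first exact: semiS1.
by apply: semiS_mulmx => //; exact: iid_with_law_semiS.
Qed.

Lemma X_simplex n w x : simplex x -> simplex (X_ xi x n w).
Proof. by move=> xS; apply: proj_act_simplex => //; exact: semiS_gprod. Qed.

(** At n = 0 this is the convention X_{-1} = X_0, with [gmat] the identity. *)
Lemma X_gmat n w x : simplex x ->
  proj_act (gmat xi n w) (X_ xi x n.-1 w) = X_ xi x n w.
Proof.
move=> xS; case: n => [|n] /=; first by rewrite proj_act1//; exact: X_simplex.
by rewrite /X_ /= -proj_actM//; [exact: iid_with_law_semiS|exact: semiS_gprod].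
Qed.

Lemma S_S x a n w : S_ xi x a n.+1 w = S_ xi x a n w + rho (xs n w) (X_ xi x n w).
Proof. by rewrite /S_ big_nat_recr//= addrA. Qed.

Lemma pathE x a n w : simplex x ->
  walk_path act rh xs (x, a) n w = (X_ xi x n w, S_ xi x a n w).
Proof.
move=> xS; elim: n => [|n IH] /=.
  by rewrite /X_ /= proj_act1// /S_ big_geq// addr0.
rewrite IH /step /=; congr pair; last by rewrite S_S.
exact: (X_gmat n.+1).
Qed.

Lemma aliveP x a n w : simplex x ->
  reflect (forall k, (0 < k <= n)%N -> 0 < S_ xi x a k w)
    (alive act rh xs (x, a) n w).
Proof.
move=> xS; elim: n => [|n IH].
  by apply: ReflectT => k /andP[k0 kn]; rewrite leqn0 in kn; rewrite (eqP kn) in k0.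
rewrite -[alive _ _ _ _ _ _]/(alive act rh xs (x, a) n w &&
  (0 < (walk_path act rh xs (x, a) n.+1 w).2)) pathE//=.
apply: (iffP andP) => [[/IH al sn] k /andP[k0]|al].
  by rewrite leq_eqVlt => /orP[/eqP ->//|kn]; apply: al; rewrite k0.
split; last by apply: al; rewrite leqnn.
by apply/IH => k /andP[k0 kn]; apply: al; rewrite k0 ltnW.
Qed.

Lemma tau_gtE x a n : simplex x ->
  tau_gt xi x a n = [set w | alive act rh xs (x, a) n w].
Proof.
move=> xS; apply/seteqP; split => w; rewrite /tau_gt /= /tau.
  case: pselect => [ex|nex] tw; apply/(aliveP _ _ _ xS) => k /andP[k0 kn].
    rewrite ltNge; apply/negP => sk; move: tw.
    case: ex_minnP => m _ mmin; rewrite ltnNge (leq_trans _ kn)//.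
    by apply: mmin; rewrite k0.
  by rewrite ltNge; apply/negP => sk; apply: nex; exists k; rewrite k0.
move=> /(aliveP _ _ _ xS) al; case: pselect => // ex.
case: ex_minnP => m /andP[m0 sm] _; rewrite ltnNge; apply/negP => mn.
by have := al m; rewrite m0 mn => /(_ isT); rewrite ltNge sm.
Qed.

Section poisson.
Variables (h : E -> R) (B : R).
Hypothesis mh : measurable_fun setT h.
Hypothesis hB : forall x, `|h x| <= B.
Hypothesis hseries : forall x, simplex x ->
  series (fun n => iter n (transition mu) (mean_rho mu) x) n @[n --> \oo] --> h x.
Hypothesis hpoisson : forall x, simplex x ->
  (\int[mu]_(g in SS) (rho g x + h (proj_act g x) - h x)%:E = 0)%E.
Hypothesis ilnN : mu.-integrable SS (fun g => (ln (mx_N g))%:E).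

(** The first term of the series is rho; by [iter_PbarE] the others are those of the series of h at
    g.x. *)
Lemma thetaE g x : semiS g -> simplex x ->
  theta mu g x = rho g x + h (proj_act g x).
Proof.
move=> gS xS; apply/cvg_lim => //; rewrite -cvg_shiftS.
rewrite (_ : [sequence _]_n = fun n => rho g x +
    series (fun n => iter n (transition mu) (mean_rho mu) (proj_act g x)) n).
  by apply: cvgD; [exact: cvg_cst|apply: hseries; exact: proj_act_simplex].
apply/funext => n; rewrite /series/= big_nat_recl//; congr (_ + _).
by apply: eq_bigr => k _; exact: iter_PbarE.
Qed.

(** With y = g.x, the Poisson equation at y says that theta(., y) - h(y) has mean 0. *)
Lemma Pbar_thetaE g x : semiS g -> simplex x ->
  Pbar mu (theta mu) g x = h (proj_act g x).
Proof.
move=> gS xS; have yS := proj_act_simplex gS xS; set y := proj_act g x in yS *.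
have mS := @measurable_semiS R d.
have i1 : mu.-integrable SS (fun g => (rho g y + h (proj_act g y) - h y)%:E).
  have iB : mu.-integrable SS (fun g => (ln (mx_N g) + 2 * B)%:E).
    apply: (integrableD mS ilnN (g := fun=> (2 * B)%:E)).
    exact: finite_measure_integrable_cst.
  apply: le_integrable iB => //.
    apply/measurable_EFinP; apply: measurable_funTS; apply: measurable_funB => //.
    apply: measurable_funD.
      exact: (@measurable_fun_pair1 _ _ _ G E _ _ y measurable_rho_pair).
    apply: (measurableT_comp mh).
    exact: (@measurable_fun_pair1 _ _ _ G E _ _ y measurable_proj_act).
  move=> k kS /=; rewrite lee_fin (le_trans _ (ler_norm _))//.
  have := rho_le_lnN kS yS; have := hB y; have := hB (proj_act k y).
  rewrite !ler_norml => /andP[? ?] /andP[? ?] /andP[? ?].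
  by apply/andP; split; lra.
have i2 : mu.-integrable SS (fun=> (h y)%:E) by exact: finite_measure_integrable_cst.
rewrite /Pbar -/y /Rintegral.
have -> : (\int[mu]_(k in SS) (theta mu k y)%:E = (h y)%:E)%E.
  transitivity (\int[mu]_(k in SS) (((fun g : G => (rho g y + h (proj_act g y) - h y)%:E)
    \+ (fun=> (h y)%:E)) k))%E.
    apply: eq_integral => k; rewrite inE => kS.
    by rewrite thetaE// /= -EFinD; congr EFin; ring.
  by rewrite integralD// hpoisson// add0e integral_cst_semiS.
by [].
Qed.

(** By the two formulas for theta, each increment is rho(g_{k+1}, X_k) + h(X_{k+1}) - h(X_k), and
    the part in h telescopes. *)
Lemma M_E x a n w : simplex x ->
  M_ mu xi x a n w = martingale act rh h xs (x, a) n w.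
Proof.
move=> xS; rewrite /martingale pathE//=.
elim: n => [|n IH].
  rewrite /M_ big_geq// /S_ big_geq// /X_ /= proj_act1//; ring.
rewrite /M_ big_nat_recr//= addrA -/(M_ mu xi x a n w) IH S_S.
rewrite thetaE; [|exact: iid_with_law_semiS|exact: X_simplex].
rewrite Pbar_thetaE; [|exact: semiS_gmat|exact: X_simplex].
rewrite X_gmat// -[proj_act _ _]/(proj_act (gmat xi n.+1 w) (X_ xi x n.+1.-1 w)).
rewrite X_gmat//; ring.
Qed.

Lemma M_tau_stop x a n w : simplex x ->
  alive act rh xs (x, a) n w -> ~~ alive act rh xs (x, a) n.+1 w ->
  M_tau mu xi x a w = martingale act rh h xs (x, a) n.+1 w.
Proof.
move=> xS /(aliveP _ _ _ xS) al /negP dn.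
have sn : S_ xi x a n.+1 w <= 0.
  rewrite leNgt; apply/negP => sn; apply: dn; apply/(aliveP _ _ _ xS) => k /andP[k0].
  by rewrite leq_eqVlt => /orP[/eqP ->//|kn]; apply: al; rewrite k0.
rewrite /M_tau /tau; case: pselect => [ex|]; last by case; exists n.+1.
case: ex_minnP => m /andP[m0 sm] mmin; suff -> : m = n.+1 by exact: M_E.
apply/eqP; rewrite eqn_leq mmin//= ltnNge; apply/negP => mn.
by have := al m; rewrite m0 mn => /(_ isT); rewrite ltNge sm.
Qed.

Lemma M_tau_alive x a w : simplex x ->
  (forall n, alive act rh xs (x, a) n w) -> M_tau mu xi x a w = 0.
Proof.
move=> xS al; rewrite /M_tau /tau; case: pselect => // ex.
exfalso; case: ex => n /andP[n0 sn].
have /(aliveP _ _ _ xS) /(_ n) := al n.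
by rewrite n0 leqnn => /(_ isT); rewrite ltNge sn.
Qed.

End poisson.
End process.
End conclusion.

Theorem proposition1p1 (R : realType) (d : nat)
    (mu : probability (borelM R d) R) (nu : probability (borelV R d) R)
    (hmu : mu semiS = 1%E)
    (hP1 : hypP1 mu) (hP2 : hypP2 mu) (hP3 : hypP3 mu)
    (hnu : mu_invariant mu nu) (hP4 : hypP4 mu nu) (hP5 : hypP5 mu)
    (dO : measure_display) (Omega : measurableType dO)
    (P : probability Omega R) (xi : nat -> {RV P >-> borelM R d})
    (hxi : iid_with_law mu xi) :
  [/\ (forall (x : 'cV[R]_d.+1) (a : R), simplex x -> 0 <= a ->
         Eon P (fun w => (S_ xi x a n w)%:E) (tau_gt xi x a n)
           @[n --> \oo] --> V mu xi x a),
      (forall (x : 'cV[R]_d.+1) (a b : R), simplex x -> 0 <= a -> a <= b ->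
         (V mu xi x a <= V mu xi x b)%E),
      (exists c A : R, [/\ 0 < c, 0 < A &
         forall (x : 'cV[R]_d.+1) (a : R), simplex x -> 0 <= a ->
           ((Num.max c^-1 (a - A))%:E <= V mu xi x a)%E /\
           (V mu xi x a <= (c * (1 + a))%:E)%E]),
      (forall x : 'cV[R]_d.+1, simplex x ->
         (V mu xi x a * (a^-1)%:E)%E @[a --> +oo] --> 1%E) &
      (forall (x : 'cV[R]_d.+1) (a : R), simplex x -> 0 <= a ->
         V mu xi x a =
         Eon P (fun w => V mu xi (X_ xi x 1 w) (S_ xi x a 1 w))
           (tau_gt xi x a 1))].
Proof.
have [delta0 delta00 /integrable_mx_N iN] := hP1.
have ilnN := integrable_ln_mx_N delta00 iN.
have sxi := iid_with_law_seq hxi; have xiS := iid_with_law_semiS hxi.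
have [n0 n0p posn0] := hP3.
have [C [r [C0 r01 decay]]] := mean_rho_decay hmu hnu hP4 ilnN sxi xiS n0p posn0.
have [h [B [mh hB hser hpois]]] := poisson_solution hmu ilnN C0 r01 decay.
have [delta delta_gt0 posd] := hP5.
set Gd := [set g | _] in posd.
(* The walk is used with eta = delta0 / 2, so that 2 eta is the exponent given by P1. *)
have iN2 : mu.-integrable (semiS : set (borelM R d))
    (fun g => (expR (2 * (delta0 / 2) * ln (mx_N g)))%:E).
  by rewrite mulrCA mulfV ?mulr1.
have mlnN : measurable_fun setT (fun g : borelM R d => ln (mx_N g)).
  by apply: measurableT_comp => //; exact: measurable_mx_N.
have GdS : Gd `<=` semiS by move=> g [].
have d20 : 0 < delta0 / 2 by rewrite divr_gt0.
have X0 : (simplex : set (borelV R d)) !=set0.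
  by exists (delta_mx ord0 ord0); exact: vertex_simplex.
have rd (g : borelM R d) (x : borelV R d) : Gd g -> simplex x -> delta <= rho g x.
  by move=> [_]; apply.
have [renE renC renM [c [A [c0 A0 renB]]] renH] :=
  @renewal_theorem R _ _ (borelM R d) (borelV R d) mu semiS simplex proj_act rho h
    (fun g => ln (mx_N g)) Gd (delta0 / 2) delta B (@measurable_semiS R d) hmu
    (@measurable_proj_act R d) (@measurable_rho_pair R d) mh mlnN
    (@proj_act_simplex R d) d20 (@rho_le_lnN R d) iN2 hB hpois
    (@measurable_rho_ge R d delta) GdS posd delta_gt0 rd X0 dO Omega P _ sxi xiS.
(* [M_tau] has the two properties asked of [Mtau], so the renewal function is a - E[M_tau]. *)
have VE (x : borelV R d) (a : R) : simplex x -> 0 <= a ->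
    V mu xi x a =
    @renewal R _ _ (borelM R d) (borelV R d) mu semiS proj_act rho (x, a).
  move=> xS a0; rewrite (renE (x, a) xS a0 (M_tau mu xi x a)).
  - by rewrite /V ltNge a0 /= expectation.unlock.
  - move=> n w; exact: (M_tau_stop hmu hxi mh hB hser hpois ilnN xS).
  - move=> w; exact: (M_tau_alive _ xS).
split.
- move=> x a xS a0; rewrite VE//.
  have := renC (x, a) xS a0; apply: cvg_trans; apply: near_eq_cvg; apply: nearW => n.
  rewrite /Eon (tau_gtE hxi a n xS) [RHS]integral_mkcond; apply: eq_integral => w _.
  rewrite patchE (pathE hxi a n w xS).
  case: ifPn => al; first by rewrite mem_set.
  by rewrite memNset//; exact/negP.
- move=> x a b xS a0 ab; rewrite !VE ?(le_trans a0)//; exact: renM.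
(* This constant C serves both bounds: 1 / C <= c, and a + A <= C (1 + a). *)
- exists (c^-1 + A + 1), A.
  have ci0 : 0 < c^-1 by rewrite invr_gt0.
  have k0 : 0 < c^-1 + A + 1 by lra.
  split => // x a xS a0; rewrite VE//; have [h1 h2 h3] := renB (x, a) xS a0.
  split.
    rewrite EFin_max ge_max h2 andbT; apply: le_trans h1; rewrite lee_fin.
    by rewrite -[leRHS]invrK lef_pV2 ?posrE//; lra.
  apply: le_trans h3 _; rewrite lee_fin /=.
  have := mulr_ge0 (ltW ci0) a0; have := mulr_ge0 (ltW A0) a0; lra.
- move=> x xS.
  have near_pos : \forall a \near +oo, 0 < a :> R by exact: nbhs_pinfty_gt.
  (* Used with s = -A and s = A, for the bounds a - A and a + A divided by a. *)
  have lim1 s : ((a + s) * a^-1)%:E @[a --> (+oo : set_system R)] --> (1%:E : \bar R).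
    apply: cvg_EFin; first exact: nearW.
    rewrite -[X in _ --> X]addr0 -[X in _ --> _ + X](mulr0 s).
    apply: (@cvg_trans _ ((1 + s * a^-1) @[a --> (+oo : set_system R)])).
      apply: near_eq_cvg; near=> a; rewrite /= mulrDl mulfV//.
      by rewrite gt_eqF//; near: a.
    apply: cvgD; first exact: cvg_cst.
    apply: cvgM; first exact: cvg_cst.
    exact: (gtr0_cvgV0 (f := id) near_pos).2 cvg_id.
  apply: (squeeze_cvge _ (lim1 (- A)) (lim1 A)).
  near=> a; have a0 : 0 < a by near: a.
  have [_ h2 h3] := renB (x, a) xS (ltW a0).
  rewrite VE ?(ltW a0)// !EFinM; apply/andP; split; apply: lee_wpmul2r => //.
    by rewrite lee_fin invr_ge0 ltW.
  by rewrite lee_fin invr_ge0 ltW.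
- move=> x a xS a0; rewrite VE// (renH (x, a) xS a0) /Eon (tau_gtE hxi a 1 xS).
  rewrite [RHS]integral_mkcond; apply: eq_integral => w _.
  rewrite patchE (pathE hxi a 1 w xS).
  case: ifPn => al; last by rewrite memNset//; exact/negP.
  rewrite mem_set//; have /(aliveP hxi _ _ _ xS) := al.
  (* Survival at time 1 means S_1 > 0, so [V] is the renewal function there and not its extension by
     0. *)
  move=> /(_ 1%N isT) s0; rewrite VE//; last exact: ltW.
  exact: (X_simplex hxi).
Unshelve. all: by end_near.
Qed.
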